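(* There exist transcendental entire functions $f$ and $g$ and infinitely many domains in $\mathbb{C}$, each of which lies in a wandering component of $F(f)$ and in a wandering component of $F(g)$, and lies in a periodic component of $F(g\circ f)$.
   Context: A domain is a nonempty open connected subset of $\mathbb{C}$. For a transcendental entire function $h$, $h^n$ denotes its $n$-th iterate, and the Fatou set is $F(h)=\{z\in\mathbb{C}: \{h^n\}_{n\in\mathbb{N}} \text{ is normal in some neighborhood of } z\}$. A component of $F(h)$ means a connected component. For a component $U$ of $F(h)$ and $k\ge 0$, let $U_k$ denote the component of $F(h)$ containing $h^k(U)$ (so $U_0=U$). The component $U$ is called wandering if $U_k\cap U_l=\emptyset$ for all $k\neq l$; otherwise it is called preperiodic. It is called periodic if $U_k=U$ for some $k\ge 1$. A domain lies in a wandering (resp. periodic, preperiodic) component of $h$ if it is contained in some wandering (resp. periodic, preperiodic) component of $F(h)$. If $f,g$ are transcendental entire, so are $f\circ g$ and $g\circ f$, and these notions apply to them. *)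

(* Defs.v *)
From HB Require Import structures.
From mathcomp Require Import all_boot all_order all_algebra.
From mathcomp Require Import all_classical all_reals all_analysis.
From mathcomp Require Import complex.

Set Implicit Arguments.
Unset Strict Implicit.
Unset Printing Implicit Defensive.

Import Order.TTheory GRing.Theory Num.Theory.
Import numFieldNormedType.Exports.

Local Open Scope classical_set_scope.
Local Open Scope complex_scope.
Local Open Scope ring_scope.

(* [R[i]] gets the topology and the norm (the complex modulus) that every
   [numFieldType] [K] carries as [K^o]. *)
HB.instance Definition _ (R : realType) := PseudoPointedMetric.copy R[i] R[i]^o.
HB.instance Definition _ (R : realType) := NormedModule.copy R[i] R[i]^o.

Section ComplexDynamics.
Variable R : realType.
Local Notation C := R[i].

Implicit Types (h : C -> C) (z : C) (U V D : set C).

(* [R[i]] is a normed module over itself, so [derivable h z 1] is complex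
   differentiability at [z]. *)
Definition entire h : Prop := forall z, derivable h z 1.

Definition transcendental_entire h : Prop :=
  entire h /\ ~ exists p : {poly C}, forall z, h z = p.[z].

Definition domain D : Prop := [/\ D !=set0, open D & connected D].

Definition cvg_infty_compacts (u : nat -> C -> C) V : Prop :=
  forall K, compactly_in V K ->
  forall M : R, \forall n \near \oo, forall z, K z -> M%:C < `|u n z|.

(* Normality in the sense of Montel; the constant limit infinity is allowed.
   A finite limit [g] of entire functions is automatically holomorphic on
   [V] when [V] is open. *)
Definition normal_on V (F : set (C -> C)) : Prop :=
  forall u : nat -> C -> C, (forall k, F (u k)) ->
  exists2 phi : nat -> nat, {homo phi : m n / (m < n)%N} &
    (exists g : C -> C,
       {family compactly_in V, (fun k => u (phi k)) @ \oo --> g}) \/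
    cvg_infty_compacts (fun k => u (phi k)) V.

Definition fatou h : set C :=
  [set z | exists2 V, open_nbhs z V & normal_on V (range (fun n => iter n h))].

Definition fatou_component h U : Prop :=
  exists2 z, fatou h z & U = connected_component (fatou h) z.

(* The component [U_k] of the Fatou set that contains [h^k(U)].  The default
   value [setT] of [xget] is never used for a component [U] of a
   transcendental entire [h]; were [U_k] missing, it would make [U] fail to be
   wandering instead of making disjointness from [U_k] trivial. *)
Definition iter_component h U (k : nat) : set C :=
  xget setT [set V | fatou_component h V /\ iter k h @` U `<=` V].

Definition wandering_component h U : Prop :=
  fatou_component h U /\
  forall k l : nat, k <> l ->
    iter_component h U k `&` iter_component h U l = set0.

Definition periodic_component h U : Prop :=
  fatou_component h U /\
  exists2 k : nat, (1 <= k)%N & iter_component h U k = U.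

Definition lies_in_wandering h D : Prop :=
  exists2 U, wandering_component h U & D `<=` U.

Definition lies_in_periodic h D : Prop :=
  exists2 U, periodic_component h U & D `<=` U.

End ComplexDynamics.

(* Main.v *)
Require Import Defs.
From mathcomp Require Import all_boot all_order all_algebra.
From mathcomp Require Import all_classical all_reals all_analysis.
From mathcomp Require Import complex ring lra.

Set Implicit Arguments.
Unset Strict Implicit.
Unset Printing Implicit Defensive.

Import Order.TTheory GRing.Theory Num.Theory.
Import numFieldNormedType.Exports.
Import ComplexField.Normc.

Local Open Scope classical_set_scope.
Local Open Scope complex_scope.
Local Open Scope ring_scope.

(** Let [h z = z + 1 - e^z] and let [f = h + 2 pi i] and [g = h - 2 pi i].  Since
    [h (z + 2 pi i) = h z + 2 pi i], the drifts cancel in [g \o f = h \o h], while the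
    [n]-th iterates of [f] and [g] are those of [h] translated by [2 pi i n] and
    [- 2 pi i n].  The points [2 pi i k] are fixed points of [h] of multiplier zero, so each
    has a disc on which the iterates of [h] converge to it.  Such a disc lies in a fixed
    component of the Fatou set of [g \o f].  Under [f] and [g] it goes to infinity, so it
    also lies in their Fatou sets, and it moves by one period at each step.  To see that it
    lies in wandering components, one has to know that the components of the points
    [2 pi i k] are distinct.

    They are separated by the lines [Im z = pi + 2 pi m], which miss the Fatou sets of [f]
    and [g] ([line_not_fatou]).  On these lines [h] acts on real parts as [x + 1 + e^x], so
    orbits tend to infinity and the only difficulty is to exclude that the iterates tend to
    infinity uniformly on a whole disc.  If a holomorphic [F] has modulus greater than one
    on a disc of radius [r], comparison of the Poincare metrics of the disc and of the
    exterior of the unit disc gives [|F'| r <= 2 |F| ln |F|] at the center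
    ([ahlfors_schwarz]).  The iterates violate this bound: if [x_0, x_1, ...] are the real
    parts along an orbit, the derivative of the [n]-th iterate is the product of all
    [1 + e^(x_k)] with [k < n], whereas [|F| ln |F|] is only of the order of the product of
    its last two factors ([orbit_multiplier_dominates]).

    The Ahlfors-Schwarz inequality is proved by the maximum principle, with second
    derivatives along the two axes, for functions that can be differentiated three times.
    Forward invariance of the Fatou sets, on which the notion of the component containing
    an image rests, follows from openness of the maps at noncritical points
    ([open_at_noncritical]).  The critical points are the points [2 pi i k] themselves and,
    for [h \o h], also their preimages under [h]; the maps send them to points [2 pi i k],
    which are known to lie in the Fatou sets. *)

(** * Discs in the complex plane *)

Section Plane.
Variable R : realType.
Local Notation C := R[i].
Local Notation Re := (@complex.Re R).
Local Notation Im := (@complex.Im R).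
Implicit Types (z w : C) (r : R).

Definition disc z r : set C := [set w | normc (w - z) < r].
Definition cdisc z r : set C := [set w | normc (w - z) <= r].

Lemma normcE z : `|z| = (normc z)%:C.
Proof. by []. Qed.

Lemma normc_ge0 z : 0 <= normc z.
Proof. by case: z => a b; exact: sqrtr_ge0. Qed.

Lemma normc_eq0 z : (normc z == 0) = (z == 0).
Proof. by apply/eqP/eqP => [/eq0_normc|->] //; rewrite normc0. Qed.

Lemma normc_gt0 z : (0 < normc z) = (z != 0).
Proof. by rewrite lt_def normc_ge0 andbT normc_eq0. Qed.

Lemma normc_real (x : R) : normc x%:C = `|x|.
Proof. by rewrite /= expr0n /= addr0 sqrtr_sqr. Qed.

Lemma normc_sub z w : normc (z - w) = normc (w - z).
Proof. by rewrite -normcN opprB. Qed.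

Lemma normc_Re z : `|Re z| <= normc z.
Proof. by rewrite -lecR -normcE normc_ge_Re. Qed.

Lemma normc_sqr z : normc z ^+ 2 = Re z ^+ 2 + Im z ^+ 2.
Proof. by case: z => a b /=; rewrite sqr_sqrtr// addr_ge0// sqr_ge0. Qed.

Lemma normc_Im z : `|Im z| <= normc z.
Proof.
rewrite -(@ler_pXn2r _ 2)// ?nnegrE ?normc_ge0// normc_sqr real_normK ?num_real//.
by rewrite lerDr sqr_ge0.
Qed.

Lemma normc_le_ReIm z : normc z <= `|Re z| + `|Im z|.
Proof.
rewrite -(@ler_pXn2r _ 2)// ?nnegrE ?normc_ge0 ?addr_ge0// normc_sqr.
rewrite sqrrD !real_normK ?num_real// -addrA lerD2l lerDr.
by rewrite mulrn_wge0 // mulr_ge0.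
Qed.

Lemma complex_gt0 (e : C) : 0 < e -> exists2 r : R, 0 < r & e = r%:C.
Proof.
rewrite ltcE /= => /andP[/eqP ie e0]; exists (Re e) => //.
by case: e ie e0 => a b /= ->.
Qed.

Lemma normc_nbhsP z (A : set C) :
  nbhs z A <-> exists2 r : R, 0 < r & disc z r `<=` A.
Proof.
split=> [/nbhs_ballP[_ /= /complex_gt0[e e0 ->] eA]|[r r0 rA]].
  by exists e => // w wz; apply: eA; rewrite -ball_normE /= distrC normcE ltcR.
apply/nbhs_ballP; exists r%:C; first by rewrite /= ltcR.
by move=> w; rewrite -ball_normE /= distrC normcE ltcR; exact: rA.
Qed.

Lemma disc_open z r : open (disc z r).
Proof.
rewrite openE => w /= wz; apply/normc_nbhsP; exists (r - normc (w - z)).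
  by rewrite subr_gt0.
move=> v /= vw; rewrite /disc /=.
have -> : v - z = (v - w) + (w - z) by ring.
by apply: le_lt_trans (le_normcD _ _) _; rewrite -ltrBrDr.
Qed.

Lemma disc_center z r : 0 < r -> disc z r z.
Proof. by move=> r0; rewrite /disc /= subrr normc0. Qed.

Lemma disc_nbhs z r : 0 < r -> nbhs z (disc z r).
Proof. by move=> r0; apply/normc_nbhsP; exists r. Qed.

Lemma normc_continuousP (f : C -> R) z :
  (forall e : R, 0 < e -> exists2 d : R, 0 < d &
     forall w, normc (w - z) < d -> `|f z - f w| < e) -> f @ z --> f z.
Proof.
move=> fz A /nbhs_ballP[e e0 eA]; have [d d0 fd] := fz _ e0.
by apply/normc_nbhsP; exists d => // w /fd fw; apply: eA; rewrite -ball_normE.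
Qed.

Lemma Re_continuous : continuous (Re : C -> R).
Proof.
move=> z; apply: normc_continuousP => e e0; exists e => // w wz.
have -> : Re z - Re w = - Re (w - z) by case: z w {wz} => a b [c d] /=; ring.
by rewrite /= normrN; apply: le_lt_trans (normc_Re _) wz.
Qed.

Lemma Im_continuous : continuous (Im : C -> R).
Proof.
move=> z; apply: normc_continuousP => e e0; exists e => // w wz.
have -> : Im z - Im w = - Im (w - z) by case: z w {wz} => a b [c d] /=; ring.
by rewrite /= normrN; apply: le_lt_trans (normc_Im _) wz.
Qed.

Lemma ler_normc_dist z w : `|normc z - normc w| <= normc (z - w).
Proof.
have h1 := le_normcD (z - w) w; have h2 := le_normcD (w - z) z.
rewrite !subrK in h1 h2; rewrite (normc_sub w z) in h2.
by rewrite ler_norml; apply/andP; split; lra.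
Qed.

Lemma normc_continuous (a : C) : continuous (fun z : C => normc (z - a)).
Proof.
move=> z; apply: normc_continuousP => e e0; exists e => // w wz.
apply: (le_lt_trans (ler_normc_dist _ _)); rewrite normc_sub.
by have -> : w - a - (z - a) = w - z by ring.
Qed.

Lemma complex_continuous : continuous (fun x : R * R => x.1 +i* x.2 : C).
Proof.
move=> x A /normc_nbhsP[r r0 rA].
have r2 : 0 < r / 2 by rewrite divr_gt0.
exists (ball x.1 (r / 2), ball x.2 (r / 2)).
  by split; exact: nbhsx_ballx.
move=> [a b] /= [xa xb]; apply: rA.
change (normc ((a +i* b) - (x.1 +i* x.2)) < r).
apply: (le_lt_trans (normc_le_ReIm _)) => /=.
move: xa xb; rewrite -!ball_normE /= (distrC a) (distrC b); lra.
Qed.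

Lemma cdisc_closed z r : closed (cdisc z r).
Proof.
have -> : cdisc z r = (fun w => normc (w - z)) @^-1` [set x | x <= r] by [].
apply: preimage_closed; last exact: closed_le.
by move=> w _; exact: normc_continuous.
Qed.

(** A closed disc is a closed subset of a square, which is the image of a product
    of two real segments. *)
Lemma cdisc_compact z r : compact (cdisc z r).
Proof.
set s1 := `[Re z - r, Re z + r]; set s2 := `[Im z - r, Im z + r].
pose square := (fun x : R * R => x.1 +i* x.2 : C) @` ([set` s1] `*` [set` s2]).
apply: (@subclosed_compact _ _ square).
- exact: cdisc_closed.
- apply: continuous_compact.
    by apply: continuous_subspaceT; exact: complex_continuous.
  by apply: compact_setX; exact: segment_compact.
- move=> w wz; exists (Re w, Im w); last by case: w {wz}.
  have h1 := le_trans (normc_Re _) wz; have h2 := le_trans (normc_Im _) wz.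
  move: h1 h2; clear square; case: w {wz} => a b; case: z @s1 @s2 => c d /=.
  rewrite !ler_norml !in_itv /= => /andP[? ?] /andP[? ?].
  by split; apply/andP; split; lra.
Qed.

Lemma disc_connected z r : 0 < r -> connected (disc z r).
Proof.
move=> r0.
have -> : disc z r = \bigcup_(w in disc z r)
    ((fun t : R => z + t%:C * (w - z)) @` `[0, 1]).
  apply/seteqP; split=> [w wz|v [w wz [t]]].
    exists w => //; exists 1; first by rewrite /= in_itv /= lexx ler01.
    by rewrite mul1r addrC subrK.
  rewrite /= in_itv /= => /andP[t0 t1] <-; rewrite /disc /= addrC addKr.
  rewrite normcM normc_real ger0_norm//; apply: le_lt_trans wz.
  by rewrite ler_piMl// normc_ge0.
apply: bigcup_connected.
  exists z => w _; exists 0; first by rewrite /= in_itv /= lexx ler01.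
  by rewrite mul0r addr0.
move=> w wz; apply: connected_continuous_connected.
  exact: segment_connected.
apply: continuous_subspaceT => t A /normc_nbhsP[e e0 eA].
have d0 : 0 < normc (w - z) + 1 by rewrite ltr_pwDr// normc_ge0.
apply/nbhs_ballP; exists (e / (normc (w - z) + 1)); first by rewrite /= divr_gt0.
move=> s; rewrite -ball_normE /= ltr_pdivlMr// => ts; apply: eA; rewrite /disc /=.
have -> : z + s%:C * (w - z) - (z + t%:C * (w - z)) = (s - t)%:C * (w - z).
  by rewrite rmorphB /=; ring.
rewrite normcM normc_real distrC; apply: le_lt_trans ts.
by rewrite ler_wpM2l// lerDl.
Qed.
End Plane.

(** * Complex derivatives *)

Section ComplexDerivative.
Variable R : realType.
Local Notation C := R[i].
Local Notation Re := (@complex.Re R).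
Local Notation Im := (@complex.Im R).
Implicit Types (F G : C -> C) (z w l m : C).

(** Reduces complex-valued functions to real-valued ones, whose sums, products and
    inverses are known to be continuous. *)
Lemma continuous_ReIm (s : C -> C) z :
  {for z, continuous s} <->
  {for z, continuous (fun w => Re (s w))} /\ {for z, continuous (fun w => Im (s w))}.
Proof.
split=> [cs|[cr ci]].
  split; apply: (@continuous_comp _ _ _ s) => //; [exact: Re_continuous|exact: Im_continuous].
have -> : s = (fun x : R * R => x.1 +i* x.2 : C) \o (fun w => (Re (s w), Im (s w))).
  by apply/funext => w /=; case: (s w).
apply: continuous_comp; last exact: complex_continuous.
exact: (cvg_pair cr ci).
Qed.

Lemma ccontinuous_cst a z : {for z, continuous (fun=> a : C)}.
Proof. by apply/continuous_ReIm; split; exact: cst_continuous. Qed.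

Lemma ccontinuous_id z : {for z, continuous (fun w : C => w)}.
Proof. by apply/continuous_ReIm; split; [exact: Re_continuous|exact: Im_continuous]. Qed.

Lemma ccontinuousD (s t : C -> C) z : {for z, continuous s} -> {for z, continuous t} ->
  {for z, continuous (fun w => s w + t w)}.
Proof.
move=> /continuous_ReIm[sr si] /continuous_ReIm[tr ti]; apply/continuous_ReIm; split.
  have -> : (fun w => Re (s w + t w)) = (fun w => Re (s w)) \+ (fun w => Re (t w)).
    by apply/funext => w /=; case: (s w) (t w) => a b [].
  exact: continuousD.
have -> : (fun w => Im (s w + t w)) = (fun w => Im (s w)) \+ (fun w => Im (t w)).
  by apply/funext => w /=; case: (s w) (t w) => a b [].
exact: continuousD.
Qed.

Lemma ccontinuousM (s t : C -> C) z : {for z, continuous s} -> {for z, continuous t} ->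
  {for z, continuous (fun w => s w * t w)}.
Proof.
move=> /continuous_ReIm[sr si] /continuous_ReIm[tr ti]; apply/continuous_ReIm; split.
  have -> : (fun w => Re (s w * t w)) =
     (fun w => Re (s w) * Re (t w)) \- (fun w => Im (s w) * Im (t w)).
    by apply/funext => w /=; case: (s w) (t w) => a b [].
  by apply: continuousB; exact: continuousM.
have -> : (fun w => Im (s w * t w)) =
   (fun w => Re (s w) * Im (t w)) \+ (fun w => Im (s w) * Re (t w)).
  by apply/funext => w /=; case: (s w) (t w) => a b [c d] /=.
by apply: continuousD; exact: continuousM.
Qed.

Lemma ccontinuousV (s : C -> C) z : s z != 0 -> {for z, continuous s} ->
  {for z, continuous (fun w => (s w)^-1)}.
Proof.
move=> sz /continuous_ReIm[sr si].
have n0 : Re (s z) * Re (s z) + Im (s z) * Im (s z) != 0.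
  by move: sz; rewrite -normc_eq0 -sqrf_eq0 normc_sqr !expr2.
have cn : {for z, continuous (fun w => (Re (s w) * Re (s w) + Im (s w) * Im (s w))^-1)}.
  by apply: continuousV => //; apply: continuousD; exact: continuousM.
apply/continuous_ReIm; split.
  have -> : (fun w => Re (s w)^-1) =
     (fun w => Re (s w) * (Re (s w) * Re (s w) + Im (s w) * Im (s w))^-1).
    by apply/funext => w /=; case: (s w) => a b /=; rewrite !expr2.
  exact: continuousM.
have -> : (fun w => Im (s w)^-1) =
   (fun w => (- Im (s w)) * (Re (s w) * Re (s w) + Im (s w) * Im (s w))^-1).
  by apply/funext => w /=; case: (s w) => a b /=; rewrite !expr2 mulNr.
by apply: continuousM => //; exact: continuousN.
Qed.

(** Caratheodory's form of differentiability: the slope function extends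
    continuously.  The rules of calculus then reduce to continuity. *)
Definition cderiv F z l : Prop :=
  exists2 s : C -> C, (forall w, F w = F z + s w * (w - z)) &
    s z = l /\ {for z, continuous s}.

Lemma cderiv_continuous F z l : cderiv F z l -> {for z, continuous F}.
Proof.
move=> [s Fs [_ cs]].
have -> : F = (fun w => F z + s w * (w - z)) by apply/funext.
apply: ccontinuousD; first exact: ccontinuous_cst.
apply: ccontinuousM; first exact: cs.
by apply: ccontinuousD; [exact: ccontinuous_id | exact: ccontinuous_cst].
Qed.

Lemma cderiv_cst a z : cderiv (fun=> a) z 0.
Proof.
exists (fun=> 0); first by move=> w; rewrite mul0r addr0.
split; [by []|].
exact: ccontinuous_cst.
Qed.

Lemma cderiv_id z : cderiv id z 1.
Proof.
exists (fun=> 1); first by move=> w; rewrite mul1r addrC subrK.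
split; [by []|].
exact: ccontinuous_cst.
Qed.

Lemma cderivD F G z l m :
  cderiv F z l -> cderiv G z m -> cderiv (fun w => F w + G w) z (l + m).
Proof.
move=> [s Fs [<- cs]] [t Gt [<- ct]]; exists (fun w => s w + t w).
  by move=> w; rewrite Fs Gt; ring.
split; [by []|].
exact: (ccontinuousD cs ct).
Qed.

Lemma cderivM F G z l m :
  cderiv F z l -> cderiv G z m -> cderiv (fun w => F w * G w) z (l * G z + F z * m).
Proof.
move=> dF dG; have cG := cderiv_continuous dG.
move: dF dG => [s Fs [<- cs]] [t Gt [<- ct]].
exists (fun w => s w * G w + F z * t w).
  move=> w; rewrite {1}Fs mulrDl {1}(Gt w); ring.
split; [by []|].
apply: ccontinuousD; first exact: (ccontinuousM cs cG).
by apply: ccontinuousM; [exact: ccontinuous_cst | exact: ct].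
Qed.

Lemma cderivV F z l : (forall w, F w != 0) ->
  cderiv F z l -> cderiv (fun w => (F w)^-1) z (- l / F z ^+ 2).
Proof.
move=> F0 dF; have cF := cderiv_continuous dF.
move: dF => [s Fs [<- cs]]; exists (fun w => - 1 * s w * (F z * F w)^-1).
  move=> w; have H : s w * (w - z) = F w - F z by rewrite [F w]Fs; ring.
  have -> : -1 * s w * (F z * F w)^-1 * (w - z) =
            - (s w * (w - z)) * (F z * F w)^-1 by rewrite mulN1r !mulNr mulrAC.
  by rewrite H; field; rewrite !F0.
split; first by rewrite expr2 mulN1r.
apply: ccontinuousM; first by apply: ccontinuousM; [exact: ccontinuous_cst | exact: cs].
apply: ccontinuousV; first by rewrite mulf_neq0.
by apply: ccontinuousM; [exact: ccontinuous_cst | exact: cF].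
Qed.

Lemma cderiv_comp F G z l m :
  cderiv F (G z) l -> cderiv G z m -> cderiv (F \o G) z (l * m).
Proof.
move=> [s Fs [sl cs]] dG; have cG := cderiv_continuous dG.
move: dG => [t Gt [<- ct]].
exists (fun w => s (G w) * t w).
  move=> w; have H : G w - G z = t w * (w - z) by rewrite [G w]Gt; ring.
  by rewrite /= (Fs (G w)) H mulrA.
split; first by rewrite sl.
exact: (ccontinuousM (continuous_comp cG cs) ct).
Qed.

End ComplexDerivative.

(** * Error bounds, and derivatives along real lines *)

Section RealDirections.
Variable R : realType.
Local Notation C := R[i].
Local Notation Re := (@complex.Re R).
Local Notation Im := (@complex.Im R).
Implicit Types (F G : C -> C) (z w l m : C).

Lemma continuous_normcP (s : C -> C) z :
  {for z, continuous s} <->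
  (forall e : R, 0 < e -> exists2 d : R, 0 < d &
     forall w, normc (w - z) < d -> normc (s w - s z) < e).
Proof.
split=> [cs e e0|H A /normc_nbhsP[e e0 eA]].
  have /normc_nbhsP[d d0 dA] := cs _ (disc_nbhs (s z) e0).
  by exists d => // w /dA.
have [d d0 dH] := H _ e0.
by apply/normc_nbhsP; exists d => // w /dH ?; exact: eA.
Qed.

(** A slope function has to be given on the whole plane, whereas error bounds only
    concern points near [z]; derivatives are transported between functions that agree
    near [z] through this form. *)
Lemma cderivP F z l : cderiv F z l <->
  (forall e : R, 0 < e -> exists2 d : R, 0 < d &
    forall w, normc (w - z) < d ->
      normc (F w - F z - l * (w - z)) <= e * normc (w - z)).
Proof.
split=> [[s Fs [<- /continuous_normcP cs]] e e0|H].
  have [d d0 dH] := cs _ e0; exists d => // w /dH ws.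
  have -> : F w - F z - s z * (w - z) = (s w - s z) * (w - z).
    by rewrite [F w]Fs; ring.
  by rewrite normcM ler_wpM2r ?normc_ge0// ltW.
pose s w := if w == z then l else (F w - F z) / (w - z).
exists s.
  move=> w; rewrite /s; case: eqVneq => [->|wz]; first by rewrite subrr mulr0 addr0.
  by rewrite divfK ?subr_eq0// addrC subrK.
have sz : s z = l by rewrite /s eqxx.
split=> //; apply/continuous_normcP => e e0.
have e2 : 0 < e / 2 by rewrite divr_gt0.
have [d d0 dH] := H _ e2; exists d => // w /dH; rewrite sz /s.
case: eqVneq => [->|wz]; first by move=> _; rewrite subrr normc0.
have n0 : 0 < normc (w - z) by rewrite normc_gt0 subr_eq0.
have -> : F w - F z - l * (w - z) = ((F w - F z) / (w - z) - l) * (w - z).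
  by rewrite mulrBl divfK// subr_eq0.
rewrite normcM ler_pM2r// => /le_lt_trans; apply; lra.
Qed.

Lemma cderiv_unique F z l m : cderiv F z l -> cderiv F z m -> l = m.
Proof.
move=> /cderivP dl /cderivP dm; apply/eqP; rewrite -subr_eq0 -normc_eq0.
rewrite eq_le normc_ge0 andbT; apply/ler_addgt0Pl => e e0; rewrite addr0.
have e2 : 0 < e / 2 by rewrite divr_gt0.
have [d1 d10 H1] := dl _ e2; have [d2 d20 H2] := dm _ e2.
pose t : R := Num.min d1 d2 / 2.
have t0 : 0 < t by rewrite divr_gt0// lt_min d10.
have tn : normc (z + t%:C - z) = t by rewrite addrC addKr normc_real gtr0_norm.
have t1 : t < d1.
  have := ge_min d1 d1 d2; rewrite lexx /= /t => h; move: t0; rewrite /t; lra.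
have t2 : t < d2.
  have := ge_min d2 d1 d2; rewrite lexx orbT /= /t => h; move: t0; rewrite /t; lra.
have := H1 (z + t%:C); have := H2 (z + t%:C); rewrite tn => /(_ t2) h2 /(_ t1) h1.
rewrite -(ler_pM2r t0).
have <- : normc ((l - m) * (z + t%:C - z)) = normc (l - m) * t by rewrite normcM tn.
have -> : (l - m) * (z + t%:C - z) =
  (F (z + t%:C) - F z - m * (z + t%:C - z)) - (F (z + t%:C) - F z - l * (z + t%:C - z)).
  by ring.
apply: le_trans (le_normcD _ _) _; rewrite normcN; lra.
Qed.

Lemma cderivable F z l : cderiv F z l -> derivable F z 1.
Proof.
move=> [s Fs [sl /continuous_normcP cs]]; apply/cvg_ex; exists l.
move=> A /normc_nbhsP[e e0 eA]; have [d d0 dH] := cs _ e0.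
apply/normc_nbhsP; exists d => // h; rewrite /disc /= subr0 => hd h0.
apply: eA; rewrite /disc /=.
have -> : h^-1 *: (F (h *: (1 : C) + z) - F z) = s (h + z).
  have -> : h *: (1 : C) = h by exact: mulr1.
  rewrite (Fs (h + z)) addrK addrC addKr.
  by have -> : h^-1 *: (s (h + z) * h) = h^-1 * (s (h + z) * h) by []; rewrite mulrC mulfK.
by rewrite -sl; apply: dH; rewrite addrK.
Qed.

Lemma cderiv_entire F : (forall z, exists l, cderiv F z l) -> entire F.
Proof. by move=> H z; have [l /cderivable] := H z. Qed.

(** The difference quotients are the real parts of the values of the slope function
    on the line, multiplied by [d]. *)
Lemma is_derive_Re F (p d : C) (t : R) l :
  cderiv F (p + t%:C * d) l ->
  is_derive t (1 : R) (fun x : R => Re (F (p + x%:C * d))) (Re (l * d)).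
Proof.
move=> [s Fs [sl /continuous_normcP cs]].
have H : (fun h : R => h^-1 *:
   (((fun x : R => Re (F (p + x%:C * d))) \o shift t) (h *: (1 : R))
   - Re (F (p + t%:C * d)))) @ 0^' --> Re (l * d).
  move=> A /nbhs_ballP[e e0 eA].
  have n0 : 0 < normc d + 1 by rewrite ltr_pwDr// normc_ge0.
  have e1 : 0 < e / (normc d + 1) by rewrite divr_gt0.
  have [c c0 cH] := cs _ e1.
  apply/nbhs_ballP; exists (c / (normc d + 1)); first by rewrite /= divr_gt0.
  move=> h; rewrite -ball_normE /= sub0r normrN ltr_pdivlMr// => hc h0.
  apply: eA; rewrite -ball_normE /=.
  have -> : h *: (1 : R) = h by exact: mulr1.
  have E : p + (h + t)%:C * d - (p + t%:C * d) = h%:C * d by rewrite rmorphD /=; ring.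
  have -> : h^-1 *: (Re (F (p + (h + t)%:C * d)) - Re (F (p + t%:C * d))) =
    Re (s (p + (h + t)%:C * d) * d).
    rewrite (Fs (p + (h + t)%:C * d)) E.
    have A1 (S D Fp : C) : h^-1 * (Re (Fp + S * (h%:C * D)) - Re Fp) = Re (S * D).
      case: S D Fp => a b [u v] [x y] /=; field; exact: h0.
    exact: A1.
  have -> : Re (l * d) - Re (s (p + (h + t)%:C * d) * d) =
            - Re ((s (p + (h + t)%:C * d) - l) * d).
    have A2 (S D L : C) : Re (L * D) - Re (S * D) = - Re ((S - L) * D).
      by case: S D L => a b [u v] [x y] /=; ring.
    exact: A2.
  rewrite normrN; apply: (le_lt_trans (normc_Re _)); rewrite normcM -sl.
  have /cH : normc (p + (h + t)%:C * d - (p + t%:C * d)) < c.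
    rewrite E normcM normc_real; apply: le_lt_trans hc.
    by rewrite ler_wpM2l// lerDl.
  rewrite ltr_pdivlMr// => h1; apply: le_lt_trans h1.
  by rewrite ler_wpM2l ?normc_ge0// lerDl.
apply: DeriveDef; first exact: (cvgP _ H).
exact: (cvg_lim (@norm_hausdorff _ _) H).
Qed.

Lemma is_derive_Im F (p d : C) (t : R) l :
  cderiv F (p + t%:C * d) l ->
  is_derive t (1 : R) (fun x : R => Im (F (p + x%:C * d))) (Im (l * d)).
Proof.
move=> dF; have := is_derive_Re (cderivM (cderiv_cst (- 'i%C) _) dF).
have -> : (fun x : R => Re (- 'i%C * F (p + x%:C * d))) = (fun x => Im (F (p + x%:C * d))).
  by apply/funext => x; case: (F _) => a b /=; ring.
have -> // : Re ((0 * F (p + t%:C * d) + - 'i%C * l) * d) = Im (l * d).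
by case: l {dF} d (F _) => a b [x y] [u v] /=; ring.
Qed.

Lemma ln_normc z : z != 0 -> ln (normc z) = ln (Re z ^+ 2 + Im z ^+ 2) / 2.
Proof.
by move=> z0; rewrite -normc_sqr lnXn ?normc_gt0// mulr2n; lra.
Qed.

(** [ln |F|] is the real part of a branch of [log F], hence the logarithmic
    derivative.  It appears as [ln (|F| ^ 2) / 2], to which the chain rule applies without
    a square root. *)
Lemma is_derive_ln_normc F (p d : C) (t : R) l :
  F (p + t%:C * d) != 0 -> cderiv F (p + t%:C * d) l ->
  is_derive t (1 : R)
     (fun x : R => ln (Re (F (p + x%:C * d)) ^+ 2 + Im (F (p + x%:C * d)) ^+ 2) / 2)
     (Re (d * (l / F (p + t%:C * d)))).
Proof.
move=> F0 dF; have dR := is_derive_Re dF; have dI := is_derive_Im dF.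
have n0 : 0 < Re (F (p + t%:C * d)) ^+ 2 + Im (F (p + t%:C * d)) ^+ 2.
  by rewrite -normc_sqr exprn_gt0// normc_gt0.
pose f := fun x : R => Re (F (p + x%:C * d)) ^+ 2 + Im (F (p + x%:C * d)) ^+ 2.
have df : is_derive t (1 : R) f
    (2 * Re (F (p + t%:C * d)) * Re (l * d) + 2 * Im (F (p + t%:C * d)) * Im (l * d)).
  have -> : f = (fun x : R => Re (F (p + x%:C * d))) ^+ 2 +
                (fun x : R => Im (F (p + x%:C * d))) ^+ 2 by [].
  apply: (is_derive_eq (is_deriveD (is_deriveX 2 dR) (is_deriveX 2 dI))).
  rewrite /= !expr1 /GRing.scale /=; ring.
have dln : is_derive (f t) (1 : R) (@ln R) (f t)^-1 by exact: is_derive1_ln.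
have dlf := is_derive1_comp dln df.
have -> : (fun x : R => ln (Re (F (p + x%:C * d)) ^+ 2 + Im (F (p + x%:C * d)) ^+ 2) / 2) =
          2^-1 *: (@ln R \o f).
  by apply/funext => x; rewrite /= /GRing.scale /= mulrC.
have E (X L D : C) : Re X ^+ 2 + Im X ^+ 2 != 0 -> 2^-1 *
   ((Re X ^+ 2 + Im X ^+ 2)^-1 * (2 * Re X * Re (L * D) + 2 * Im X * Im (L * D))) =
   Re (D * (L / X)).
  by case: X L D => a b [c e] [x y] /= n; field.
by apply: is_derive_eq; rewrite /GRing.scale /=; apply: E; rewrite gt_eqF.
Qed.

End RealDirections.

(** * The second derivative at a maximum *)

Section RealCalculus.
Variable R : realType.
Implicit Types (f g : R -> R) (x : R).

Lemma is_derive_eps f x l : is_derive x (1 : R) f l ->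
  forall e : R, 0 < e -> exists2 d : R, 0 < d &
    forall t, `|t| < d -> `|f (x + t) - f x - l * t| <= e * `|t|.
Proof.
move=> [df dl] e e0.
have H : (fun h : R => h^-1 *: ((f \o shift x) (h *: (1 : R)) - f x)) @ 0^' --> l.
  by rewrite -dl; exact: df.
have /nbhs_ballP[d /= d0 dH] := H _ (nbhsx_ballx l _ e0).
exists d => // t td; have [->|t0] := eqVneq t 0.
  by rewrite addr0 subrr mulr0 subr0 normr0 mulr0.
have := dH t; rewrite -!ball_normE /= sub0r normrN => /(_ td t0).
have -> : t *: (1 : R) = t by exact: mulr1.
rewrite /GRing.scale /= => lt.
have -> : f (x + t) - f x - l * t = (t^-1 * (f (t + x) - f x) - l) * t.
  by rewrite (addrC x); field.
by rewrite normrM distrC ler_wpM2r// ltW.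
Qed.

Lemma is_derive_div f g x a b : g x != 0 ->
  is_derive x (1 : R) f a -> is_derive x (1 : R) g b ->
  is_derive x (1 : R) (fun t => f t / g t) (a / g x - f x * b / g x ^+ 2).
Proof.
move=> gx fa gb.
have gV : is_derive x (1 : R) (fun t => (g t)^-1) (- (g x) ^- 2 *: b).
  split; first exact: derivableV.
  by rewrite deriveV// derive_val.
apply: (is_derive_eq (is_deriveM fa gV)).
by rewrite /GRing.scale /=; field.
Qed.

(** If [a] were positive, [f'] would be positive just to the right of its zero [0]
    and [f] would increase there. *)
Lemma second_derivative_at_max f f' a e : 0 < e ->
  (forall t, `|t| < e -> is_derive t (1 : R) f (f' t)) ->
  is_derive (0 : R) (1 : R) f' a ->
  (forall t, `|t| < e -> f t <= f 0) -> a <= 0.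
Proof.
move=> e0 df df' fmax; rewrite leNgt; apply/negP => a0.
have iv t : t \in `](- e), e[ -> `|t| < e by rewrite in_itv /= ltr_norml.
have z0 : (0 : R) \in `](- e), e[ by rewrite in_itv /= oppr_lt0 e0.
have f'0 : f' 0 = 0.
  have d0 : is_derive (0 : R) (1 : R) f 0.
    apply: (@derive1_at_max _ f (- e) e 0) => //; first by lra.
    - by move=> t /iv /df; case.
    - by move=> t /iv; exact: fmax.
  have [_ <-] := df 0 (iv _ z0); by have [_ ->] := d0.
have a2 : 0 < a / 2 by lra.
have [d d0 dH] := is_derive_eps df' a2.
have pos t : 0 < t -> t < d -> 0 < f' t.
  move=> t0 td; have := dH t; rewrite add0r f'0 subr0 gtr0_norm// => /(_ td).
  by rewrite ler_norml => /andP[h _]; nra.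
pose t := Num.min d e / 2.
have m0 : 0 < Num.min d e by rewrite lt_min d0.
have md : Num.min d e <= d by rewrite ge_min lexx.
have me : Num.min d e <= e by rewrite ge_min lexx orbT.
have t0 : 0 < t by rewrite /t; lra.
have td : t < d by rewrite /t; lra.
have te : t < e by rewrite /t; lra.
have in0t s : 0 <= s -> s <= t -> `|s| < e.
  by move=> s0 st; rewrite ger0_norm//; apply: le_lt_trans te.
have [||c] := @MVT R f f' 0 t t0.
- move=> s; rewrite in_itv /= => /andP[s0 st].
  by apply: df; apply: in0t; exact: ltW.
- apply: continuous_in_subspaceT => s; rewrite inE /= in_itv /= => /andP[s0 st].
  have [ds _] := df s (in0t _ s0 st).
  by apply: differentiable_continuous; apply/derivable1_diffP.
rewrite in_itv /= subr0 => /andP[c0 ct] E.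
have := fmax t (in0t _ (ltW t0) (lexx t)).
have := pos c c0 (lt_trans ct td); nra.
Qed.
End RealCalculus.

(** * The Ahlfors-Schwarz inequality for functions of modulus greater than one *)

Section LogDensity.
Variable R : realType.
Local Notation C := R[i].
Local Notation Re := (@complex.Re R).
Local Notation Im := (@complex.Im R).
Implicit Types (F G : C -> C) (z w l m : C).

Lemma cderiv_near F G z l e : 0 < e -> (forall w, normc (w - z) < e -> F w = G w) ->
  cderiv F z l -> cderiv G z l.
Proof.
move=> e0 FG /cderivP dF; apply/cderivP => c c0; have [d d0 dH] := dF _ c0.
exists (Num.min d e); first by rewrite lt_min d0.
move=> w; rewrite lt_min => /andP[wd we]; rewrite -!FG ?subrr ?normc0//.
exact: dH.
Qed.

(** [G] is first replaced by a function without zeros that agrees with it near [z]. *)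
Lemma cderiv_div F G z l m : G z != 0 -> cderiv F z l -> cderiv G z m ->
  cderiv (fun w => F w / G w) z (l / G z - F z * m / G z ^+ 2).
Proof.
move=> Gz dF dG.
have n0 : 0 < normc (G z) by rewrite normc_gt0.
have /continuous_normcP/(_ _ n0)[e e0 He] := cderiv_continuous dG.
pose H w := if G w == 0 then G z else G w.
have Hn w : H w != 0 by rewrite /H; case: ifPn.
have HG w : normc (w - z) < e -> G w = H w.
  move=> /He; rewrite /H; case: eqVneq => // ->.
  by rewrite sub0r normcN ltxx.
have dH : cderiv H z m by exact: (cderiv_near e0 HG dG).
have Hz : H z = G z by rewrite -HG// subrr normc0.
have := cderivM dF (cderivV Hn dH); rewrite Hz.
have -> : l * (G z)^-1 + F z * (- m / G z ^+ 2) = l / G z - F z * m / G z ^+ 2 by ring.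
apply: (cderiv_near e0) => w /HG -> //.
Qed.

(** Up to a constant, [|F1| c / (|F| ln |F|)] is the density of the metric
    [|dw| / (|w| ln |w|)] of the exterior of the unit disc, pulled back by [F], divided by
    the density of the Poincare metric of the disc of radius [r] around [z0].  Its
    logarithm has a maximum at [p] on the line of direction [d], where the second
    derivative is therefore nonpositive.  The terms linear in [q0] and [q1] are those of
    harmonic functions: they change sign when [d] is multiplied by ['i]. *)
Lemma log_density_second_derivative (F F1 F2 : C -> C) (z0 p d q0 q1 : C) (r e : R) :
  (forall z, cderiv F z (F1 z)) -> (forall z, cderiv F1 z (F2 z)) ->
  cderiv (fun w => F1 w / F w) p q0 -> cderiv (fun w => F2 w / F1 w) p q1 -> 0 < e ->
  let M t := ln (Re (F (p + t%:C * d)) ^+ 2 + Im (F (p + t%:C * d)) ^+ 2) / 2 in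
  let N t := ln (Re (F1 (p + t%:C * d)) ^+ 2 + Im (F1 (p + t%:C * d)) ^+ 2) / 2 in
  let c t := r ^+ 2 - (Re (p - z0) + t * Re d) ^+ 2 - (Im (p - z0) + t * Im d) ^+ 2 in
  (forall t : R, `|t| < e ->
    [/\ F (p + t%:C * d) != 0, F1 (p + t%:C * d) != 0, 0 < M t & 0 < c t] /\
    N t - M t - ln (M t) + ln (c t) <= N 0 - M 0 - ln (M 0) + ln (c 0)) ->
  Re (d * (q1 * d)) - Re (d * (q0 * d))
  - (Re (d * (q0 * d)) / M 0 - Re (d * (F1 p / F p)) ^+ 2 / M 0 ^+ 2)
  + (- 2 * (Re d ^+ 2 + Im d ^+ 2) / c 0
     - (2 * (Re (p - z0) * Re d + Im (p - z0) * Im d)) ^+ 2 / c 0 ^+ 2) <= 0.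
Proof.
move=> dF dF1 dq0 dq1 e0 M N c H.
have dM t : `|t| < e ->
    is_derive t (1 : R) M (Re (d * (F1 (p + t%:C * d) / F (p + t%:C * d)))).
  move=> /H[[h1 _ _ _] _]; exact: (is_derive_ln_normc h1 (dF (p + t%:C * d))).
have dN t : `|t| < e ->
    is_derive t (1 : R) N (Re (d * (F2 (p + t%:C * d) / F1 (p + t%:C * d)))).
  move=> /H[[_ h1 _ _] _]; exact: (is_derive_ln_normc h1 (dF1 (p + t%:C * d))).
pose c' t := - 2 * ((Re (p - z0) + t * Re d) * Re d + (Im (p - z0) + t * Im d) * Im d).
have aff (a b t : R) : is_derive t (1 : R) (fun t => a + t * b) b.
  have -> : (fun t => a + t * b) = (cst a : R -> R) + (fun t => t * b) by [].
  have -> : (fun t : R => t * b) = (id : R -> R) * (cst b : R -> R) by [].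
  apply: (is_derive_eq (is_deriveD (is_derive_cst _ _ _)
    (is_deriveM (is_derive_id _ _) (is_derive_cst _ _ _)))).
  by rewrite /GRing.scale /=; ring.
have dc t : is_derive t (1 : R) c (c' t).
  have -> : c = (cst (r ^+ 2) : R -> R) - (fun t => Re (p - z0) + t * Re d) ^+ 2
     - (fun t => Im (p - z0) + t * Im d) ^+ 2 by [].
  apply: (is_derive_eq (is_deriveB (is_deriveB (is_derive_cst _ _ _)
    (is_deriveX 2 (aff _ _ _))) (is_deriveX 2 (aff _ _ _)))).
  by rewrite /c' /GRing.scale /= !expr1; ring.
have dc' t : is_derive t (1 : R) c' (- 2 * (Re d ^+ 2 + Im d ^+ 2)).
  have -> : c' = (fun t => (- 2 * (Re (p - z0) * Re d + Im (p - z0) * Im d))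
                           + t * (- 2 * (Re d ^+ 2 + Im d ^+ 2))).
    by apply/funext => x; rewrite /c'; ring.
  exact: aff.
pose f t := N t - M t - ln (M t) + ln (c t).
pose f' t := Re (d * (F2 (p + t%:C * d) / F1 (p + t%:C * d)))
  - Re (d * (F1 (p + t%:C * d) / F (p + t%:C * d)))
  - Re (d * (F1 (p + t%:C * d) / F (p + t%:C * d))) / M t + c' t / c t.
have p0 : p + (0 : R)%:C * d = p by rewrite mul0r addr0.
have z0e : `|0 : R| < e by rewrite normr0.
have [[F0 F10 M0 c0] _] := H _ z0e.
rewrite p0 in F0 F10.
have df t : `|t| < e -> is_derive t (1 : R) f (f' t).
  move=> te; have [[_ _ Mt ct] _] := H _ te.
  have dlM : is_derive (M t) (1 : R) (@ln R) (M t)^-1 by exact: is_derive1_ln.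
  have dlc : is_derive (c t) (1 : R) (@ln R) (c t)^-1 by exact: is_derive1_ln.
  have h1 := is_derive1_comp dlM (dM t te).
  have h2 := is_derive1_comp dlc (dc t).
  have -> : f = N - M - (@ln R \o M) + (@ln R \o c) by [].
  apply: (is_derive_eq (is_deriveD (is_deriveB (is_deriveB (dN t te) (dM t te)) h1) h2)).
  by rewrite /f' /GRing.scale /= [M t]lock [c t]lock; ring.
have dQ1 : is_derive (0 : R) (1 : R)
   (fun t => Re (d * (F2 (p + t%:C * d) / F1 (p + t%:C * d)))) (Re (d * (q1 * d))).
  rewrite -p0 in dq1; have := is_derive_Re (cderivM (cderiv_cst d _) dq1).
  by rewrite mul0r add0r mulrA.
have dQ0 : is_derive (0 : R) (1 : R)
   (fun t => Re (d * (F1 (p + t%:C * d) / F (p + t%:C * d)))) (Re (d * (q0 * d))).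
  rewrite -p0 in dq0; have := is_derive_Re (cderivM (cderiv_cst d _) dq0).
  by rewrite mul0r add0r mulrA.
have M0n : M 0 != 0 by rewrite gt_eqF.
have c0n : c 0 != 0 by rewrite gt_eqF.
have df' := is_deriveD (is_deriveB (is_deriveB dQ1 dQ0) (is_derive_div M0n dQ0 (dM 0 z0e)))
  (is_derive_div c0n (dc' 0) (dc 0)).
have := second_derivative_at_max e0 df df' (fun t te => (H t te).2).
apply: le_trans.
rewrite p0 /c'; set A := Re (d * (F1 p / F p)).
rewrite !mul0r !addr0 le_eqVlt; apply/orP; left; apply/eqP.
rewrite [M 0]lock [c 0]lock; ring.
Qed.
End LogDensity.

Section AhlforsSchwarz.
Variable R : realType.
Local Notation C := R[i].
Local Notation Re := (@complex.Re R).
Local Notation Im := (@complex.Im R).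
Implicit Types (F G : C -> C) (z w l m : C).

Lemma continuous_normc_comp (F : C -> C) z :
  {for z, continuous F} -> {for z, continuous (fun w => normc (F w))}.
Proof.
move=> /continuous_normcP cF; apply: normc_continuousP => e /cF[d d0 dH].
exists d => // w /dH; apply: le_lt_trans; rewrite normc_sub.
exact: ler_normc_dist.
Qed.

Lemma normc_line (p d : C) (e t : R) : normc d = 1 -> `|t| < e ->
  normc (p + t%:C * d - p) < e.
Proof. by move=> d1 te; rewrite addrC addKr normcM normc_real d1 mulr1. Qed.

(** Ahlfors' method.  The quotient [phi] of the two densities vanishes on the boundary
    of the disc, so that it has an interior maximum [p].  There the second derivatives of
    [ln phi] along [1] and ['i] are nonpositive, and their sum is
    [|F1 / F| ^ 2 / u ^ 2 - 4 r ^ 2 / c ^ 2] with [u = ln |F|], because the metric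
    [|dw| / (|w| ln |w|)] has constant negative curvature.  This bounds [phi] at [p], hence
    at the center. *)
Theorem ahlfors_schwarz (F F1 F2 F3 : C -> C) (z0 : C) (r : R) :
  (forall z, cderiv F z (F1 z)) -> (forall z, cderiv F1 z (F2 z)) ->
  (forall z, cderiv F2 z (F3 z)) -> 0 < r ->
  (forall z, normc (z - z0) <= r -> 1 < normc (F z)) ->
  normc (F1 z0) * r <= 2 * (normc (F z0) * ln (normc (F z0))).
Proof.
move=> dF dF1 dF2 r0 F_gt1.
have [F10|F10] := eqVneq (F1 z0) 0.
  rewrite F10 normc0 mul0r mulr_ge0// mulr_ge0 ?normc_ge0// ln_ge0//.
  by apply/ltW/F_gt1; rewrite subrr normc0 ltW.
pose u z := ln (normc (F z)).
pose c z := r ^+ 2 - normc (z - z0) ^+ 2.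
pose phi z := normc (F1 z) * c z / (normc (F z) * u z).
have u_gt0 z : normc (z - z0) <= r -> 0 < u z.
  by move=> /F_gt1 h; rewrite ln_gt0.
have F_gt0 z : normc (z - z0) <= r -> 0 < normc (F z).
  by move=> /F_gt1; apply: lt_trans.
have F_neq0 z : normc (z - z0) <= r -> F z != 0.
  by move=> /F_gt0; rewrite normc_gt0.
have cphi : {within cdisc z0 r, continuous phi}.
  apply: continuous_in_subspaceT => z; rewrite inE => zr.
  have cF := continuous_normc_comp (cderiv_continuous (dF z)).
  have cF1 := continuous_normc_comp (cderiv_continuous (dF1 z)).
  have cu : {for z, continuous u}.
    apply: (@continuous_comp _ _ _ (fun w => normc (F w)) (@ln R)); first exact: cF.
    by apply: continuous_ln; exact: F_gt0.
  have cc : {for z, continuous c}.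
    apply: continuousB; first exact: cst_continuous.
    have cn := @normc_continuous R z0 z.
    have -> : (fun w => normc (w - z0) ^+ 2) = (fun w => normc (w - z0) * normc (w - z0)).
      by apply/funext => w; rewrite expr2.
    exact: (continuousM cn cn).
  have n0 : normc (F z) * u z != 0.
    by rewrite mulf_neq0// gt_eqF// ?F_gt0 ?u_gt0.
  have n1 := continuousM cF cu; have n2 := continuousM cF1 cc.
  exact: (continuousM n2 (@continuousV _ _ (fun w => normc (F w) * u w) z n0 n1)).
have K0 : cdisc z0 r !=set0 by exists z0; rewrite /cdisc /= subrr normc0 ltW.
have [p] := compact_EVT_max K0 (@cdisc_compact R z0 r) cphi.
rewrite inE => pr pmax.
have z0r : normc (z0 - z0) <= r by rewrite subrr normc0 ltW.
have c_z0 : c z0 = r ^+ 2 by rewrite /c subrr normc0 expr0n /= subr0.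
have phi_z0 : 0 < phi z0.
  by rewrite /phi c_z0 divr_gt0 ?mulr_gt0 ?exprn_gt0 ?u_gt0 ?F_gt0// normc_gt0.
have phi_p : phi z0 <= phi p by apply: pmax; rewrite inE.
have phi_p0 := lt_le_trans phi_z0 phi_p.
have cp_ge0 : 0 <= c p.
  by rewrite /c subr_ge0 ler_pXn2r ?nnegrE ?normc_ge0 ?(ltW r0).
have F1p : F1 p != 0.
  by apply/eqP => h; move: phi_p0; rewrite /phi h normc0 !mul0r ltxx.
have cp : 0 < c p.
  rewrite lt_neqAle cp_ge0 andbT; apply/eqP => h.
  by move: phi_p0; rewrite /phi -h mulr0 mul0r ltxx.
have pr' : normc (p - z0) < r.
  by move: cp; rewrite /c subr_gt0 ltr_pXn2r ?nnegrE ?normc_ge0 ?(ltW r0).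
have F1p0 : 0 < normc (F1 p) by rewrite normc_gt0.
have /continuous_normcP/(_ _ F1p0)[e1 e10 He1] := cderiv_continuous (dF1 p).
pose e := Num.min e1 (r - normc (p - z0)).
have e0 : 0 < e by rewrite lt_min e10 subr_gt0.
have near_p z : normc (z - p) < e -> normc (z - z0) < r /\ F1 z != 0.
  rewrite lt_min => /andP[h1 h2]; split.
    have -> : z - z0 = (z - p) + (p - z0) by ring.
    by apply: le_lt_trans (le_normcD _ _) _; rewrite -ltrBrDr.
  by apply/eqP => h; move: (He1 _ h1); rewrite h sub0r normcN ltxx.
have c_gt0 z : normc (z - z0) < r -> 0 < c z.
  by move=> zr; rewrite /c subr_gt0 ltr_pXn2r ?nnegrE ?normc_ge0 ?(ltW r0).
have lnphi z : normc (z - p) < e ->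
    ln (phi z) = (ln (normc (F1 z)) - ln (u z) + ln (c z)) - u z.
  move=> /near_p[zr F1z]; have zr' := ltW zr.
  have := F_gt0 _ zr'; have := u_gt0 _ zr'; have := c_gt0 _ zr.
  have : 0 < normc (F1 z) by rewrite normc_gt0.
  move=> h1 h2 h3 h4; rewrite /phi lnM ?posrE ?invr_gt0 ?mulr_gt0// lnV ?posrE ?mulr_gt0//.
  by rewrite !lnM ?posrE// -/(u z); ring.
have ln_F z : normc (z - z0) <= r -> u z = ln (Re (F z) ^+ 2 + Im (F z) ^+ 2) / 2.
  by move=> /F_neq0; exact: ln_normc.
pose q0 := F2 p / F p - F1 p * F1 p / F p ^+ 2.
pose q1 := F3 p / F1 p - F2 p * F2 p / F1 p ^+ 2.
have dq0 : cderiv (fun w => F1 w / F w) p q0 by apply: cderiv_div => //; exact: F_neq0.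
have dq1 : cderiv (fun w => F2 w / F1 w) p q1 by exact: cderiv_div.
have key d : normc d = 1 ->
  Re (d * (q1 * d)) - Re (d * (q0 * d))
  - (Re (d * (q0 * d)) / u p - Re (d * (F1 p / F p)) ^+ 2 / u p ^+ 2)
  + (- 2 / c p - (2 * (Re (p - z0) * Re d + Im (p - z0) * Im d)) ^+ 2 / c p ^+ 2) <= 0.
  move=> d1.
  have d2 : Re d ^+ 2 + Im d ^+ 2 = 1 by rewrite -normc_sqr d1 expr1n.
  have cE t : c (p + t%:C * d) =
      r ^+ 2 - (Re (p - z0) + t * Re d) ^+ 2 - (Im (p - z0) + t * Im d) ^+ 2.
    have rE (a b v : C) : Re (a + t%:C * b - v) = Re (a - v) + t * Re b.
      by case: a b v => ? ? [? ?] [? ?] /=; ring.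
    have iE (a b v : C) : Im (a + t%:C * b - v) = Im (a - v) + t * Im b.
      by case: a b v => ? ? [? ?] [? ?] /=; ring.
    by rewrite /c normc_sqr rE iE opprD addrA.
  have p0 : p + (0 : R)%:C * d = p by rewrite mul0r addr0.
  have := @log_density_second_derivative R F F1 F2 z0 p d q0 q1 r e dF dF1 dq0 dq1 e0.
  rewrite /= -!cE p0 -!(ln_F p pr) d2 mulr1; apply.
  move=> t te; have tp := normc_line p d1 te.
  have [zr F1z] := near_p _ tp; have zr' := ltW zr.
  rewrite -!cE -!ln_F// -!ln_normc//; split.
    by rewrite F_neq0// F1z u_gt0// c_gt0.
  have := pmax (p + t%:C * d); rewrite inE => /(_ zr') phi_le.
  have phi_gt0 : 0 < phi (p + t%:C * d).
    by rewrite /phi divr_gt0// ?mulr_gt0 ?c_gt0 ?F_gt0 ?u_gt0// normc_gt0.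
  move: phi_le; rewrite -ler_ln ?posrE// !lnphi ?subrr ?normc0//.
  by lra.
(* Adding the inequalities for the two directions cancels [q0] and [q1]. *)
have n1 : normc (1 : C) = 1 by rewrite normc1.
have ni : normc ('i%C : C) = 1 by rewrite /= expr0n /= expr1n add0r sqrtr1.
have k1 := key _ n1; have k2 := key _ ni; clear key.
have up := u_gt0 _ pr.
have XX : normc (F1 p / F p) ^+ 2 / u p ^+ 2 <= 4 * r ^+ 2 / c p ^+ 2.
  have E : 4 * r ^+ 2 / c p ^+ 2 =
    4 / c p + 4 * (Re (p - z0) ^+ 2 + Im (p - z0) ^+ 2) / c p ^+ 2.
    rewrite -normc_sqr; have -> : r ^+ 2 = c p + normc (p - z0) ^+ 2 by rewrite /c subrK.
    have : c p != 0 by rewrite gt_eqF.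
    by move: (c p) => cc ccn; field.
  rewrite E normc_sqr; move: k1 k2; move: (F1 p / F p) (p - z0) q0 q1 {dq0 dq1} (u p) (c p).
  move=> [X Y] [a b] [x y] [v w] U cc /=.
  rewrite !(mulr0, mulr1, mul0r, mul1r, subr0, addr0, add0r, sub0r, oppr0).
  by lra.
have up2 : 0 < u p ^+ 2 by rewrite exprn_gt0.
have cp2 : 0 < c p ^+ 2 by rewrite exprn_gt0.
have X2 : normc (F1 p / F p) * c p <= 2 * r * u p.
  rewrite -(@ler_pXn2r _ 2)// ?nnegrE ?mulr_ge0 ?normc_ge0 ?(ltW up) ?(ltW cp) ?(ltW r0)//.
  move: XX; rewrite ler_pdivrMr// mulrAC ler_pdivlMr// => XX.
  by rewrite !exprMn; apply: le_trans XX _; rewrite expr2; lra.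
have phip2r : phi p <= 2 * r.
  rewrite /phi ler_pdivrMr ?mulr_gt0 ?F_gt0//.
  move: X2; rewrite normcM normcV mulrAC ler_pdivrMr ?F_gt0// => h.
  by apply: le_trans h _; rewrite le_eqVlt; apply/orP; left; apply/eqP; ring.
have : phi z0 <= 2 * r by exact: le_trans phi_p phip2r.
rewrite /phi c_z0 ler_pdivrMr ?mulr_gt0 ?F_gt0 ?u_gt0// => h.
by rewrite -(ler_pM2r r0); move: h; rewrite /u expr2; lra.
Qed.
End AhlforsSchwarz.

(** * The complex exponential and repeated differentiability *)

Section ComplexExponential.
Variable R : realType.
Local Notation C := R[i].
Local Notation Re := (@complex.Re R).
Local Notation Im := (@complex.Im R).
Implicit Types (F G : C -> C) (z w l m : C).

Definition cexp z : C := (expR (Re z))%:C * (cos (Im z) +i* sin (Im z)).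

Lemma cexpD z w : cexp (z + w) = cexp z * cexp w.
Proof.
case: z w => a b [c d]; rewrite /cexp /= expRD cosD sinD.
by apply/eqP; rewrite eq_complex /=; apply/andP; split; apply/eqP; ring.
Qed.

Lemma cexp0 : cexp 0 = 1.
Proof. by rewrite /cexp /= expR0 cos0 sin0 mul1r. Qed.

Lemma normc_cexp z : normc (cexp z) = expR (Re z).
Proof.
rewrite /cexp normcM normc_real ger0_norm ?expR_ge0//=.
by rewrite cos2Dsin2 sqrtr1 mulr1.
Qed.

Lemma cderiv_cexp0 : cderiv cexp 0 1.
Proof.
apply/cderivP => e e0.
(* The errors of the real and imaginary parts add up to at most [8 e' |w|]. *)
pose e' := Num.min e 1 / 8.
have m0 : 0 < Num.min e 1 by rewrite lt_min e0 ltr01.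
have me : Num.min e 1 <= e by rewrite ge_min lexx.
have m1 : Num.min e 1 <= 1 by rewrite ge_min lexx orbT.
have e'0 : 0 < e' by rewrite /e'; lra.
have e'1 : e' < 1 by rewrite /e'; lra.
have [d1 d10 H1] := is_derive_eps (is_derive_expR (0 : R)) e'0.
have [d2 d20 H2] := is_derive_eps (is_derive_cos (0 : R)) e'0.
have [d3 d30 H3] := is_derive_eps (is_derive_sin (0 : R)) e'0.
pose d := Num.min (Num.min d1 d2) (Num.min d3 e').
exists d; first by rewrite !lt_min d10 d20 d30 e'0.
move=> w; rewrite subr0 !lt_min => /andP[/andP[w1 w2] /andP[w3 we]].
have xn := normc_Re w; have yn := normc_Im w.
have := H3 (Im w) (le_lt_trans yn w3); have := H2 (Im w) (le_lt_trans yn w2).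
have := H1 (Re w) (le_lt_trans xn w1).
rewrite !add0r expR0 cos0 sin0 oppr0 addr0 mul0r mul1r !subr0 mul1r => h1 h2 h3.
rewrite cexp0 mul1r; apply: (le_trans (normc_le_ReIm _)).
set x := Re w in xn h1 *; set y := Im w in yn h2 h3 *.
have -> : Re (cexp w - 1 - w) = (expR x - 1 - x) * cos y + (1 + x) * (cos y - 1).
  by rewrite /x /y /cexp; case: w {w1 w2 w3 we xn yn h1 h2 h3 x y} => a b /=; ring.
have -> : Im (cexp w - 1 - w) = (expR x - 1) * sin y + (sin y - y).
  by rewrite /x /y /cexp; case: w {w1 w2 w3 we xn yn h1 h2 h3 x y} => a b /=; ring.
set n := normc w in xn yn we *.
have n0 : 0 <= n by exact: normc_ge0.
have b1 : `|(expR x - 1 - x) * cos y| <= e' * n.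
  rewrite normrM -[leRHS]mulr1 ler_pM//.
    by apply: le_trans h1 _; rewrite ler_wpM2l// ltW.
  by rewrite ler_norml cos_geN1 cos_le1.
have b2 : `|(1 + x) * (cos y - 1)| <= 2 * (e' * n).
  rewrite normrM ler_pM//.
    by apply: (le_trans (ler_normD _ _)); rewrite normr1; lra.
  by apply: le_trans h2 _; rewrite ler_wpM2l// ltW.
have b4 : `|sin y - y| <= e' * n.
  by apply: le_trans h3 _; rewrite ler_wpM2l// ltW.
have b3 : `|(expR x - 1) * sin y| <= (2 * e') * (2 * n).
  rewrite normrM ler_pM//.
    have -> : expR x - 1 = (expR x - 1 - x) + x by ring.
    apply: (le_trans (ler_normD _ _)).
    have := normr_ge0 x; nra.
  have -> : sin y = (sin y - y) + y by ring.
  apply: (le_trans (ler_normD _ _)); nra.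
have t1 := ler_normD ((expR x - 1 - x) * cos y) ((1 + x) * (cos y - 1)).
have t2 := ler_normD ((expR x - 1) * sin y) (sin y - y).
have : 8 * (e' * n) <= e * n by rewrite mulrA ler_wpM2r// /e'; lra.
lra.
Qed.

Lemma cderiv_cexp z : cderiv cexp z (cexp z).
Proof.
have -> : cexp = fun w => cexp z * cexp (w + (- z)).
  by apply/funext => w; rewrite -cexpD; congr cexp; ring.
have d1 : cderiv (fun w => w + (- z)) z (1 + 0).
  exact: cderivD (cderiv_id z) (cderiv_cst _ _).
have d2 : cderiv cexp (z + (- z)) 1 by rewrite subrr; exact: cderiv_cexp0.
have := cderivM (cderiv_cst (cexp z) z) (@cderiv_comp R cexp (fun w => w + (- z)) z _ _ d2 d1).
by rewrite /= subrr cexp0 mul0r add0r addr0 mulr1.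
Qed.

(** The Ahlfors-Schwarz inequality involves three derivatives of an iterate; in this
    form they exist by closure under composition, without being computed. *)
Fixpoint smooth (n : nat) F : Prop :=
  if n is k.+1 then exists2 F', (forall z, cderiv F z (F' z)) & smooth k F' else True.

Lemma smoothW n F : smooth n.+1 F -> smooth n F.
Proof.
elim: n F => [|n IH] F //= [F' dF sF']; exists F' => //; exact: IH.
Qed.

Lemma smooth_cst n (a : C) : smooth n (fun=> a).
Proof.
elim: n a => [|n IH] a //=; exists (fun=> 0) => // z; exact: cderiv_cst.
Qed.

Lemma smooth_id n : smooth n id.
Proof.
case: n => [|n] //=; exists (fun=> 1); last exact: smooth_cst.
by move=> z; exact: cderiv_id.
Qed.

Lemma smoothD n F G : smooth n F -> smooth n G -> smooth n (fun z => F z + G z).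
Proof.
elim: n F G => [|n IH] F G //= [F' dF sF] [G' dG sG].
exists (fun z => F' z + G' z); last exact: IH.
by move=> z; exact: cderivD.
Qed.

Lemma smoothM n F G : smooth n F -> smooth n G -> smooth n (fun z => F z * G z).
Proof.
elim: n F G => [|n IH] F G // sF sG.
have sF' := smoothW sF; have sG' := smoothW sG; move: sF sG => [F' dF sF] [G' dG sG].
exists (fun z => F' z * G z + F z * G' z); last by apply: smoothD; exact: IH.
by move=> z; exact: cderivM.
Qed.

Lemma smooth_comp n F G : smooth n F -> smooth n G -> smooth n (F \o G).
Proof.
elim: n F G => [|n IH] F G // sF sG.
have sG' := smoothW sG; move: sF sG => [F' dF sF] [G' dG sG].
exists (fun z => (F' \o G) z * G' z); last by apply: smoothM => //; exact: IH.
by move=> z; exact: cderiv_comp.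
Qed.

Lemma smooth_cexp n : smooth n cexp.
Proof. by elim: n => [|n IH] //=; exists cexp => // z; exact: cderiv_cexp. Qed.

Lemma smooth_iter n F k : smooth n F -> smooth n (iter k F).
Proof.
move=> sF; elim: k => [|k IH]; first exact: smooth_id.
exact: (smooth_comp sF IH).
Qed.

End ComplexExponential.

(** * Orbits and multipliers on the lines where the exponential is negative *)

Section Growth.
Variable R : realType.
Implicit Types (x : R).

(** The action of [z + 1 - e^z] on real parts, on a line where [e^z] is negative. *)
Definition real_step x : R := x + 1 + expR x.

(** The derivative of the [n]-th iterate of [z + 1 - e^z] at the point of such a line
    with real part [x]. *)
Fixpoint orbit_multiplier x (n : nat) : R :=
  if n is k.+1 then orbit_multiplier x k * (1 + expR (iter k real_step x)) else 1.

Lemma orbit_multiplier_ge1 x n : 1 <= orbit_multiplier x n.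
Proof.
by elim: n => [|n IH] //=; have := expR_gt0 (iter n real_step x); nra.
Qed.

Lemma real_orbit_ge x n : x + n%:R <= iter n real_step x.
Proof.
elim: n => [|n IH] /=; first by rewrite addr0.
by rewrite /real_step -natr1; have := expR_gt0 (iter n real_step x); lra.
Qed.

Lemma eventually_ge_natr x : exists N : nat, forall n, (N <= n)%N -> x <= n%:R.
Proof.
exists (Num.truncn x).+1 => n Nn.
have [x0|x0] := leP 0 x; last by apply: le_trans (ltW x0) _.
have /andP[_ h] := truncn_itv x0.
by apply: le_trans (ltW h) _; rewrite ler_nat.
Qed.

Lemma real_orbit_cvg x M : exists N : nat, forall n, (N <= n)%N -> M <= iter n real_step x.
Proof.
have [N HN] := eventually_ge_natr (M - x); exists N => n /HN h.
by apply: le_trans (real_orbit_ge x n); lra.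
Qed.

Lemma orbit_multiplier_cvg x M :
  exists N : nat, forall n, (N <= n)%N -> M <= orbit_multiplier x n.
Proof.
have [N1 H1] := real_orbit_cvg x 0.
have H k : 1 + k%:R <= orbit_multiplier x (N1 + k).
  elim: k => [|k IH]; first by rewrite addr0 orbit_multiplier_ge1.
  rewrite addnS /= -natr1.
  have := expR_ge1Dx (iter (N1 + k) real_step x); have := H1 _ (leq_addr k N1).
  have := ler0n R k; nra.
have [N2 H2] := eventually_ge_natr M; exists (N1 + N2)%N => n Nn.
have /H2 h : (N2 <= n - N1)%N by rewrite leq_subRL// (leq_trans _ Nn)// leq_addr.
have := H (n - N1)%N; rewrite subnKC ?(leq_trans _ Nn) ?leq_addr//; lra.
Qed.

(** The last point of the orbit is comparable to the exponential of the one before it,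
    and its logarithm to that point itself; the multiplier also contains the exponentials
    of all the earlier points. *)
Lemma orbit_multiplier_dominates x (A B K : R) : 0 <= A -> 0 <= B -> 0 <= K ->
  exists N : nat, forall n, (N <= n)%N ->
    let L := `|iter n real_step x| + A * n%:R + B in
    K * (L * ln L) < orbit_multiplier x n.
Proof.
move=> A0 B0 K0.
have [N1 H1] := real_orbit_cvg x (1 + 2 * (A + `|A * (1 - x) + B| + 1)).
have [N2 H2] := eventually_ge_natr (1 + 2 * (A + `|A * (1 - x) + B| + 1) - x).
have [N3 H3] := orbit_multiplier_cvg x (1 + 40 * K).
exists (N1 + N2 + N3).+2 => -[|[|n]]//; rewrite !ltnS => Nn /=.
have /H1 x0_big : (N1 <= n)%N by apply: leq_trans Nn; rewrite -addnA leq_addr.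
have /H2 n_big : (N2 <= n)%N by apply: leq_trans Nn; rewrite addnAC leq_addl.
have /H3 P_big : (N3 <= n)%N by apply: leq_trans Nn; rewrite leq_addl.
set D := `|_| in x0_big n_big.
have D0 : 0 <= D by exact: normr_ge0.
have DE : A * (1 - x) + B <= D by exact: ler_norm.
have orb_n := real_orbit_ge x n.
have P1 := orbit_multiplier_ge1 x n.
(* With [x0], [x1], [x2] the last three points, [L] is at most [4 e^x1] and [ln L] at
   most [5 x1], where [x1 <= 2 e^x0]; so [40 K < P] suffices for the multiplier
   [P (1 + e^x0) (1 + e^x1)]. *)
set x0 := iter n real_step x in x0_big P_big orb_n *.
set P := orbit_multiplier x n in P_big P1 *.
set x1 := real_step x0; set x2 := real_step x1.
have e0 := expR_ge1Dx x0; have e1 := expR_ge1Dx x1.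
have x1E : x1 = x0 + 1 + expR x0 by [].
have x2E : x2 = x1 + 1 + expR x1 by [].
have q1 : 1 + x1 ^+ 2 / 2 <= expR x1.
  by apply: (@expR_ge1Dxn R x1 1); lra.
have lin : A * n.+2%:R + B <= x2.
  rewrite -natr1 -natr1.
  have y1 : 1 + 2 * (A + D + 1) <= x + n%:R by lra.
  have x1y : x + n%:R + 1 <= x1 by lra.
  have : (x + n%:R + 1) * (x + n%:R + 1) <= x1 * x1 by nra.
  move: q1; rewrite expr2 => q1 q2.
  set y := x + n%:R in y1 x1y q2 orb_n.
  have -> : n%:R = y - x by rewrite /y; ring.
  have : (1 + 2 * (A + D + 1)) * y <= y * y by nra.
  nra.
have x2_ge1 : 1 <= x2 by lra.
rewrite (ger0_norm (le_trans ler01 x2_ge1)).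
set L := x2 + _ + B.
have L1 : 1 <= L by have := ler0n R n.+2; rewrite /L; nra.
have L2 : L <= 4 * expR x1 by rewrite /L; lra.
have lnL : ln L <= 5 * x1.
  apply: (@le_trans _ _ (ln (4 * expR x1))).
    by rewrite ler_ln ?posrE; lra.
  rewrite lnM ?posrE ?expR_gt0// expRK.
  have : ln (4 : R) <= 4 by apply: ltW; apply: ln_sublinear.
  lra.
have lnL0 : 0 <= ln L by exact: ln_ge0.
have LL : L * ln L <= 4 * expR x1 * (5 * x1) by apply: ler_pM => //; lra.
have KL : K * (L * ln L) <= K * (4 * expR x1 * (5 * x1)) by exact: ler_wpM2l.
apply: le_lt_trans KL _.
have a1 : x1 <= 2 * expR x0 by lra.
have x1p : 0 < x1 by lra.
have E1 := expR_gt0 x1; have E0 := expR_gt0 x0.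
have s1 : 20 * K * x1 < P * (1 + expR x0).
  apply: (@le_lt_trans _ _ (40 * K * expR x0)); first by nra.
  nra.
apply: (@le_lt_trans _ _ (20 * K * x1 * expR x1)).
  by rewrite le_eqVlt; apply/orP; left; apply/eqP; ring.
apply: (@lt_trans _ _ (P * (1 + expR x0) * expR x1)); first by rewrite ltr_pM2r.
rewrite ltr_pM2l ?ltrDr//; nra.
Qed.
End Growth.

(** * Normal sequences and open maps *)

Section Normality.
Variable R : realType.
Local Notation C := R[i].
Implicit Types (F G : C -> C) (z w l m : C) (V K : set C).

Lemma compact_cvgP (u : nat -> C -> C) V (g : C -> C) :
  {family compactly_in V, u @ \oo --> g} <->
  (forall K, compactly_in V K -> forall e : R, 0 < e ->
    exists N : nat, forall n, (N <= n)%N -> forall z, K z -> normc (u n z - g z) < e).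
Proof.
have FF : Filter (u @ \oo) by exact: fmap_filter.
split.
- move/(@fam_cvgP _ _ _ (u @ \oo) g FF) => ug K VK e e0.
  have [|N _ HN] := ug K VK [set h | forall z, K z -> normc (h z - g z) < e].
    apply/uniform_nbhs; exists [set xy | ball xy.1 e%:C xy.2]; split.
      by rewrite -entourage_ballE; exists e%:C => //=; rewrite ltcR.
    move=> h H z Kz; have := H z Kz.
    by rewrite /= -ball_normE /= normcE ltcR normc_sub.
  by exists N => n /HN.
- move=> H; apply/(@fam_cvgP _ _ _ (u @ \oo) g FF) => K VK P /uniform_nbhs[E [+ EP]].
  rewrite -entourage_ballE => -[e /= /complex_gt0[r r0 ->] eE].
  have [N HN] := H K VK r r0; exists N => // n /HN Hn; apply: EP => z Kz.
  by apply: eE; rewrite /= -ball_normE /= normcE ltcR normc_sub; exact: Hn.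
Qed.

Lemma cvg_inftyP (u : nat -> C -> C) V :
  cvg_infty_compacts u V <->
  (forall K, compactly_in V K -> forall M : R,
    exists N : nat, forall n, (N <= n)%N -> forall z, K z -> M < normc (u n z)).
Proof.
split=> H K VK M; have := H K VK M.
- by move=> [N _ HN]; exists N => n /HN Hn z /Hn; rewrite normcE ltcR.
- by move=> [N HN]; exists N => // n /HN Hn z /Hn; rewrite normcE ltcR.
Qed.

Lemma extraction (P : nat -> nat -> Prop) :
  (forall k N, exists2 n, (N <= n)%N & P k n) ->
  exists2 phi : nat -> nat, {homo phi : m n / (m < n)%N} & forall k, P k (phi k).
Proof.
move=> H.
have [s Hs] : {s : nat -> nat -> nat & forall k N, (N <= s k N)%N /\ P k (s k N)}.
  have /choice[s Hs] : forall kN : nat * nat, exists n, (kN.2 <= n)%N /\ P kN.1 n.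
    by move=> [k N]; have [n ? ?] := H k N; exists n.
  by exists (fun k N => s (k, N)) => k N; exact: (Hs (k, N)).
pose phi := fix phi k := if k is j.+1 then s j.+1 (phi j).+1 else s 0%N 0%N.
exists phi.
  apply: homo_ltn; first exact: ltn_trans.
  by move=> k /=; have [] := Hs k.+1 (phi k).+1.
by case=> [|k] /=; [have [] := Hs 0%N 0%N|have [] := Hs k.+1 (phi k).+1].
Qed.

(** A sequence of terms of [F] either repeats one of them infinitely often or has a
    subsequence whose indices tend to infinity. *)
Lemma normal_range (F : nat -> C -> C) V :
  (exists g, {family compactly_in V, F @ \oo --> g}) \/ cvg_infty_compacts F V ->
  normal_on V (range F).
Proof.
move=> cF u uF.
have /choice[m Hm] : forall k, exists n, F n = u k.
  by move=> k; have [n _ <-] := uF k; exists n.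
have [[j Hj]|Hinf] := pselect (exists j, forall N, exists2 n, (N <= n)%N & m n = j).
  have [phi phi_incr Hphi] := @extraction (fun _ n => m n = j) (fun _ => Hj).
  exists phi => //; left; exists (F j); apply/compact_cvgP => K VK e e0.
  by exists 0%N => n _ z _; rewrite -Hm Hphi subrr normc0.
have m_infty k : exists N, forall n, (N <= n)%N -> (k <= m n)%N.
  elim: k => [|k [N HN]]; first by exists 0%N.
  have : exists N', forall n, (N' <= n)%N -> m n <> k.
    apply: contrapT => nN; apply: Hinf; exists k => N'; apply: contrapT => nn.
    by apply: nN; exists N' => n N'n mk; apply: nn; exists n.
  move=> [N' HN']; exists (maxn N N') => n; rewrite geq_max => /andP[h1 h2].
  by rewrite ltn_neqAle HN// andbT eq_sym; apply/eqP; exact: HN'.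
have [phi phi_incr Hphi] : exists2 phi : nat -> nat,
    {homo phi : m n / (m < n)%N} & forall k, (k <= m (phi k))%N.
  apply: (@extraction (fun k n => (k <= m n)%N)) => k N.
  have [N' HN'] := m_infty k.
  by exists (maxn N N'); [exact: leq_maxl | apply/HN'; exact: leq_maxr].
exists phi => //; case: cF => [[g /compact_cvgP Fg]|/cvg_inftyP Foo].
- left; exists g; apply/compact_cvgP => K VK e e0; have [N HN] := Fg K VK e e0.
  by exists N => n Nn z; rewrite -Hm; apply: HN; exact: leq_trans (Hphi n).
- right; apply/cvg_inftyP => K VK M; have [N HN] := Foo K VK M.
  by exists N => n Nn z; rewrite -Hm; apply: HN; exact: leq_trans (Hphi n).
Qed.

(** For [v] close to [F z], the minimum of [|F - v|] on a small closed disc around [z]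
    is not on the boundary.  It is zero, since otherwise moving from the minimum point [p]
    in the direction [- (F p - v) / F' p] would decrease [|F - v|]. *)
Lemma open_at_noncritical F F' z : (forall w, cderiv F w (F' w)) ->
  {for z, continuous F'} -> F' z != 0 -> forall e : R, 0 < e ->
  exists2 rho : R, 0 < rho & disc (F z) rho `<=` F @` cdisc z e.
Proof.
move=> dF cF' F'z e e0.
have n0 : 0 < normc (F' z) by rewrite normc_gt0.
have [d1 d10 H1] : exists2 d : R, 0 < d & forall w, normc (w - z) < d -> F' w != 0.
  move/continuous_normcP : cF' => /(_ _ n0)[d d0 dH]; exists d => // w /dH h.
  by apply/eqP => F'w; move: h; rewrite F'w sub0r normcN ltxx.
have n2 : 0 < normc (F' z) / 2 by rewrite divr_gt0.
have [d2 d20 H2] := (cderivP F z (F' z)).1 (dF z) _ n2.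
pose d := Num.min (Num.min d1 d2) e / 2.
have m0 : 0 < Num.min (Num.min d1 d2) e by rewrite !lt_min d10 d20.
have l1 : Num.min (Num.min d1 d2) e <= d1 by rewrite !ge_min lexx.
have l2 : Num.min (Num.min d1 d2) e <= d2 by rewrite !ge_min lexx orbT.
have l3 : Num.min (Num.min d1 d2) e <= e by rewrite !ge_min lexx !orbT.
have d0 : 0 < d by rewrite /d; lra.
have dd1 : d < d1 by rewrite /d; lra.
have dd2 : d < d2 by rewrite /d; lra.
have de : d <= e by rewrite /d; lra.
pose rho := normc (F' z) * d / 4.
have rho0 : 0 < rho by rewrite divr_gt0// mulr_gt0.
exists rho => // v; rewrite /disc /= => vF.
have cg : continuous (fun w => normc (F w - v)).
  move=> w; have := @normc_continuous R v (F w).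
  exact: continuous_comp (cderiv_continuous (dF w)).
have K0 : cdisc z d !=set0 by exists z; rewrite /cdisc /= subrr normc0 ltW.
have [p] := compact_EVT_min K0 (@cdisc_compact R z d) (continuous_subspaceT cg).
rewrite inE => pd pmin.
have Fpz : normc (F p - v) < rho.
  have := pmin z; rewrite inE => /(_ _)/le_lt_trans; apply.
    by rewrite /cdisc /= subrr normc0 ltW.
  by rewrite normc_sub.
have pd' : normc (p - z) < d.
  rewrite lt_neqAle pd andbT; apply/eqP => pdE.
  have := H2 p; rewrite pdE => /(_ dd2) h.
  have t1 := le_normcD (F' z * (p - z)) (F p - F z - F' z * (p - z)).
  have t1' : F' z * (p - z) = (F p - F z) - (F p - F z - F' z * (p - z)) by ring.
  have t2 := le_normcD (F p - F z) (- (F p - F z - F' z * (p - z))).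
  rewrite -t1' normcN normcM pdE in t2.
  have t3 := le_normcD (F p - v) (v - F z).
  have t3' : F p - v + (v - F z) = F p - F z by ring.
  rewrite t3' in t3; rewrite /rho in Fpz vF; lra.
exists p; first by rewrite /cdisc /=; apply: le_trans pd de.
apply/eqP; rewrite -subr_eq0; apply/negPn/negP => D0.
set D := F p - v in D0.
have F'p : F' p != 0 by apply: H1; exact: le_lt_trans dd1.
pose q := - D / F' p.
have q0 : 0 < normc q by rewrite normc_gt0 mulf_neq0 ?invr_eq0// oppr_eq0.
have D1 : 0 < normc D by rewrite normc_gt0.
have e1 : 0 < normc D / 2 / normc q by rewrite !divr_gt0.
have [c c0 Hc] := (cderivP F p (F' p)).1 (dF p) _ e1.
pose s := Num.min (Num.min c (d - normc (p - z))) (normc q).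
have s0 : 0 < s by rewrite !lt_min c0 subr_gt0 pd' q0.
have s1 : s <= c by rewrite !ge_min lexx.
have s2 : s <= d - normc (p - z) by rewrite !ge_min lexx !orbT.
have s3 : s <= normc q by rewrite !ge_min lexx !orbT.
pose t := s / normc q / 2.
have t0 : 0 < t by rewrite !divr_gt0.
have tq : normc (t%:C * q) = s / 2.
  rewrite normcM normc_real gtr0_norm// /t; field; exact: lt0r_neq0.
have t1 : t <= 1 / 2 by rewrite /t ler_pM2r// ler_pdivrMr// mul1r.
have w_z : normc (p + t%:C * q - z) <= d.
  have -> : p + t%:C * q - z = (p - z) + t%:C * q by ring.
  by apply: le_trans (le_normcD _ _) _; rewrite tq; lra.
have w_p : normc (p + t%:C * q - p) = s / 2 by rewrite addrC addKr.
have := Hc (p + t%:C * q); rewrite w_p => /(_ _) h.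
have {h} : normc (F (p + t%:C * q) - F p - F' p * (p + t%:C * q - p)) <=
  normc D / 2 / normc q * (s / 2) by apply: h; lra.
have -> : normc D / 2 / normc q * (s / 2) = normc D / 2 * t.
  by rewrite /t; field; exact: lt0r_neq0.
have -> : F (p + t%:C * q) - F p - F' p * (p + t%:C * q - p) =
  (F (p + t%:C * q) - v) - (1 - t)%:C * D.
  have -> : F' p * (p + t%:C * q - p) = - t%:C * D.
    by rewrite /q; field.
  by rewrite rmorphB rmorph1 /D; ring.
move=> h; have := pmin (p + t%:C * q); rewrite inE => /(_ w_z).
have t4 := le_normcD ((F (p + t%:C * q) - v) - (1 - t)%:C * D) ((1 - t)%:C * D).
rewrite subrK normcM normc_real ger0_norm in t4; last by lra.
rewrite -/D; nra.
Qed.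

End Normality.

(** * Fatou components *)

Section FatouSet.
Variable R : realType.
Local Notation C := R[i].
Local Notation Im := (@complex.Im R).
Local Notation fatou := Defs.fatou.
Implicit Types (F G : C -> C) (z w a : C) (V K U D : set C).

Lemma complex_hausdorff : hausdorff_space C.
Proof. exact: norm_hausdorff. Qed.

(** [F] maps a closed disc around [z] onto a neighbourhood of [F z].  Compact sets
    near [F z] thus lift to compact sets near [z], and a limit of the iterates at a point
    near [F z] can be read off at any of its preimages. *)
Lemma fatou_forward F F' z : (forall w, cderiv F w (F' w)) ->
  {for z, continuous F'} -> F' z != 0 -> fatou F z -> fatou F (F z).
Proof.
move=> dF cF' F'z [V [oV Vz] nV].
have /normc_nbhsP[e e0 eV] : nbhs z V by exact: open_nbhs_nbhs.
have e2 : 0 < e / 2 by rewrite divr_gt0.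
have eV2 : cdisc z (e / 2) `<=` V.
  by move=> w we; apply: eV; rewrite /disc /=; apply: le_lt_trans we _; lra.
have [rho rho0 Hrho] := open_at_noncritical dF cF' F'z e2.
have cF : continuous F by move=> w; exact: cderiv_continuous (dF w).
exists (disc (F z) rho).
  by split; [exact: disc_open | exact: disc_center].
move=> u uF.
have uF' k : range (fun n => iter n F) (u k \o F).
  have [n _ <-] := uF k; exists n.+1 => //.
  by apply/funext => w; rewrite /= -iterS iterSr.
have [phi phi_incr Hphi] := nV _ uF'; exists phi => //.
have /choice[s Hs] : forall w, exists v, disc (F z) rho w -> cdisc z (e / 2) v /\ F v = w.
  move=> w; have [/Hrho[v ve vw]|nw] := pselect (disc (F z) rho w).
    by exists v.
  by exists 0.
have lift K : compactly_in (disc (F z) rho) K ->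
    exists2 K', compactly_in V K' & forall w, K w -> K' (s w) /\ F (s w) = w.
  move=> [KV cK]; exists (cdisc z (e / 2) `&` F @^-1` K).
    split; first by move=> w [] /eV2.
    apply: (@subclosed_compact _ _ (cdisc z (e / 2))).
    - apply: closedI; first exact: cdisc_closed.
      apply: preimage_closed; first by move=> w _; exact: cF.
      exact: compact_closed complex_hausdorff cK.
    - exact: cdisc_compact.
    - by move=> w [].
  move=> w Kw; have [h1 h2] := Hs w (KV _ Kw).
  by split => //; split => //; rewrite /= h2.
case: Hphi => [[g /compact_cvgP Hg]|/cvg_inftyP Hoo].
- left; exists (g \o s); apply/compact_cvgP => K /lift[K' K'V HK] r r0.
  have [N HN] := Hg K' K'V r r0; exists N => n Nn w Kw.
  have [h1 h2] := HK w Kw.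
  by have := HN n Nn (s w) h1; rewrite /= h2.
- right; apply/cvg_inftyP => K /lift[K' K'V HK] M.
  have [N HN] := Hoo K' K'V M; exists N => n Nn w Kw.
  have [h1 h2] := HK w Kw.
  by have := HN n Nn (s w) h1; rewrite /= h2.
Qed.

Section Components.
Variable F : C -> C.
Hypothesis F_continuous : continuous F.
Hypothesis F_fatou : forall z, fatou F z -> fatou F (F z).

Lemma iter_fatou n z : fatou F z -> fatou F (iter n F z).
Proof. by move=> Fz; elim: n => //= n; exact: F_fatou. Qed.

Lemma iter_continuous n : continuous (iter n F).
Proof.
elim: n => [|n IH] z; first exact: ccontinuous_id.
have -> : iter n.+1 F = F \o iter n F by [].
by apply: continuous_comp; [exact: IH | exact: F_continuous].
Qed.

Lemma iter_connected_component n a : fatou F a ->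
  iter n F @` connected_component (fatou F) a `<=`
  connected_component (fatou F) (iter n F a).
Proof.
move=> Fa; apply: connected_component_max.
- by exists a => //; exact: connected_component_refl.
- by move=> _ [z /connected_component_sub Fz <-]; exact: iter_fatou.
- apply: connected_continuous_connected; first exact: component_connected.
  by apply: continuous_subspaceT; exact: iter_continuous.
Qed.

(** The component on the right satisfies the condition that defines the choice on the
    left, and any set satisfying it is a component that meets this one. *)
Lemma iter_componentE n a : fatou F a ->
  iter_component F (connected_component (fatou F) a) n =
  connected_component (fatou F) (iter n F a).
Proof.
move=> Fa; rewrite /iter_component.
set P := [set _ | _].
have : P (xget setT P).
  apply: xgetPex; exists (connected_component (fatou F) (iter n F a)).
  split; last exact: iter_connected_component.
  by exists (iter n F a) => //; exact: iter_fatou.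
move=> [[z Fz ->] H].
apply: same_connected_component; apply: H; exists a => //.
exact: connected_component_refl.
Qed.

Lemma connected_fatou_sub a D : D a -> connected D -> D `<=` fatou F ->
  D `<=` connected_component (fatou F) a.
Proof. by move=> Da cD DF; exact: connected_component_max. Qed.

Lemma lies_in_wandering_component a D : D a -> connected D -> D `<=` fatou F ->
  (forall k l : nat, k <> l ->
    connected_component (fatou F) (iter k F a) `&`
    connected_component (fatou F) (iter l F a) = set0) ->
  lies_in_wandering F D.
Proof.
move=> Da cD DF H; exists (connected_component (fatou F) a).
  split; first by exists a => //; exact: DF.
  by move=> k l kl; rewrite !iter_componentE; [exact: H | exact: DF..].
exact: connected_fatou_sub.
Qed.

Lemma lies_in_fixed_component a D : F a = a -> D a -> connected D -> D `<=` fatou F ->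
  lies_in_periodic F D.
Proof.
move=> Faa Da cD DF; exists (connected_component (fatou F) a).
  split; first by exists a => //; exact: DF.
  by exists 1%N => //; rewrite iter_componentE /= ?Faa//; exact: DF.
exact: connected_fatou_sub.
Qed.
End Components.

(** Multiplier zero makes [F] at least halve the distance to [a] on a disc around [a]. *)
Lemma superattracting_basin F a : F a = a -> cderiv F a 0 ->
  exists2 r : R, 0 < r & forall n z, disc a r z -> normc (iter n F z - a) <= r / 2 ^+ n.
Proof.
move=> Faa /cderivP dF; have h2 : 0 < 1 / 2 :> R by rewrite divr_gt0.
have [r r0 Hr] := dF _ h2; exists r => //.
have half z : normc (z - a) < r -> normc (F z - a) <= normc (z - a) / 2.
  by move=> /Hr; rewrite Faa mul0r subr0; lra.
move=> n z zr.
suff [] : normc (iter n F z - a) < r /\ normc (iter n F z - a) <= r / 2 ^+ n by [].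
elim: n => [|n [IH1 IH2]] /=; first by rewrite expr0 divr1 ltW.
have h := half _ IH1; have := normc_ge0 (iter n F z - a) => h0; split.
  by apply: le_lt_trans IH1; apply: le_trans h _; lra.
apply: le_trans h _; rewrite exprS invfM mulrCA (mulrC 2^-1).
by rewrite ler_pM2r ?invr_gt0.
Qed.

(** The imaginary parts of the points of a component form an interval. *)
Lemma component_strip F a (b c : R) : fatou F a -> b < Im a < c ->
  (forall z, Im z = b \/ Im z = c -> ~ fatou F z) ->
  forall w, connected_component (fatou F) a w -> b < Im w < c.
Proof.
move=> Fa /andP[ba ac] H w aw.
have cIm : connected (Im @` connected_component (fatou F) a).
  apply: connected_continuous_connected; first exact: component_connected.
  by apply: continuous_subspaceT; exact: Im_continuous.
have itv := (connected_intervalP _).1 cIm.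
have ina : (Im @` connected_component (fatou F) a) (Im a).
  by exists a => //; exact: connected_component_refl.
have inw : (Im @` connected_component (fatou F) a) (Im w) by exists w.
apply/andP; split; rewrite ltNge; apply/negP => wb.
- have [z /connected_component_sub Fz zb] : (Im @` connected_component (fatou F) a) b.
    by apply: (itv _ _ inw ina); rewrite wb ltW.
  by apply: (H z) => //; left.
- have [z /connected_component_sub Fz zb] : (Im @` connected_component (fatou F) a) c.
    by apply: (itv _ _ ina inw); rewrite wb ltW.
  by apply: (H z) => //; right.
Qed.
End FatouSet.

(** * The drifting maps and their Julia lines *)

Section Maps.
Variable R : realType.
Local Notation C := R[i].
Local Notation Re := (@complex.Re R).
Local Notation Im := (@complex.Im R).
Local Notation fatou := Defs.fatou.
Implicit Types (z w a : C) (k s : int) (x y : R).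

Lemma pi2_ge0 : 0 <= (pi : R) *+ 2.
Proof. by rewrite mulrn_wge0// pi_ge0. Qed.

(** The periods of the exponential. *)
Definition tau k : C := 0 +i* (k%:~R * (pi *+ 2)).

(** Newton's method for [e^z - 1], conjugated by [z -> - z]: the zeros [tau k] of
    [e^z - 1] are fixed points of multiplier zero. *)
Definition core_map z : C := z + (1 + - 1 * cexp z).

(** The drift commutes with [core_map], so that iterates of [drift_map s] and of
    [core_map] differ by a translation. *)
Definition drift_map s z : C := core_map z + tau s.

Lemma tau0 : tau 0 = 0.
Proof. by rewrite /tau mul0r. Qed.

Lemma tauD k l : tau (k + l) = tau k + tau l.
Proof. by rewrite /tau rmorphD /= mulrDl; apply/eqP; rewrite eq_complex /= addr0 !eqxx. Qed.

Lemma cos_int x k : cos (x + k%:~R * (pi *+ 2)) = cos x.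
Proof.
case: k => n; first by rewrite -pmulrn mulr_natl (periodicn (@cosD2pi R)).
rewrite NegzE -(periodicn (@cosD2pi R) n.+1) mulrNz mulNr -mulr_natl.
by congr cos; ring.
Qed.

Lemma sin_int x k : sin (x + k%:~R * (pi *+ 2)) = sin x.
Proof.
case: k => n; first by rewrite -pmulrn mulr_natl (periodicn (@sinD2pi R)).
rewrite NegzE -(periodicn (@sinD2pi R) n.+1) mulrNz mulNr -mulr_natl.
by congr sin; ring.
Qed.

Lemma cexp_tau z k : cexp (z + tau k) = cexp z.
Proof. by case: z => a b; rewrite /cexp /= addr0 cos_int sin_int. Qed.

Lemma core_map_tau z k : core_map (z + tau k) = core_map z + tau k.
Proof. by rewrite /core_map cexp_tau; ring. Qed.

Lemma core_map_fix k : core_map (tau k) = tau k.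
Proof. by rewrite /core_map -[tau k]add0r cexp_tau cexp0; ring. Qed.

Lemma iter_drift_map s n z : iter n (drift_map s) z = iter n core_map z + tau (s * n%:Z).
Proof.
elim: n => [|n IH] /=; first by rewrite mulr0 tau0 addr0.
by rewrite IH /drift_map core_map_tau -addrA -tauD intS mulrDr mulr1 addrC (addrC (s * _)) addrC.
Qed.

Lemma drift_map_comp z : drift_map (-1) (drift_map 1 z) = core_map (core_map z).
Proof. by rewrite /drift_map core_map_tau -addrA -tauD subrr tau0 addr0. Qed.

Lemma cderiv_drift_map s z : cderiv (drift_map s) z (1 - cexp z).
Proof.
have d1 := cderivM (cderiv_cst (-1) z) (cderiv_cexp z).
have := cderivD (cderivD (cderiv_id z) (cderivD (cderiv_cst 1 z) d1)) (cderiv_cst (tau s) z).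
by rewrite mul0r !add0r addr0 mulN1r.
Qed.

Lemma drift_map0 : drift_map 0 = core_map.
Proof. by apply/funext => z; rewrite /drift_map tau0 addr0. Qed.

Lemma cderiv_core_map z : cderiv core_map z (1 - cexp z).
Proof. by rewrite -drift_map0; exact: cderiv_drift_map. Qed.

Lemma smooth_drift_map n s : smooth n (drift_map s).
Proof.
apply: smoothD; last exact: smooth_cst.
apply: smoothD; first exact: smooth_id.
apply: smoothD; first exact: smooth_cst.
by apply: smoothM; [exact: smooth_cst | exact: smooth_cexp].
Qed.

Lemma cos_eq1 x : cos x = 1 -> exists k : int, x = k%:~R * (pi *+ 2).
Proof.
move=> cx; have pi2 : 0 < (pi : R) *+ 2 by rewrite mulrn_wgt0// pi_gt0.
pose k := Num.floor (x / (pi *+ 2)).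
have /andP[k1 k2] := floor_itv (x / (pi *+ 2)).
rewrite -/k in k1 k2; rewrite ler_pdivlMr// in k1.
rewrite ltr_pdivrMr// rmorphD mulrDl mul1r /= in k2.
exists k; pose y := x - k%:~R * (pi *+ 2).
have cy : cos y = 1.
  by rewrite -cx -(cos_int y k) /y subrK.
apply/eqP; rewrite -subr_eq0 -/y; apply/negPn/negP => y0.
have y_gt0 : 0 < y / 2 by rewrite divr_gt0// lt_neqAle eq_sym y0 /y subr_ge0.
have y_lt : y / 2 < pi by rewrite ltr_pdivrMr// mulr_natr /y; lra.
have := @sin_gt0_pi R (y / 2); rewrite y_gt0 y_lt => /(_ isT) sy.
have := cos_mulr2n (y / 2); have -> : (y / 2) *+ 2 = y by rewrite -mulr_natr; field.
rewrite cy cos2sin2 mulr2n => E.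
have : 0 < sin (y / 2) ^+ 2 by rewrite exprn_gt0.
lra.
Qed.

Lemma cexp_eq1 z : cexp z = 1 -> exists k, z = tau k.
Proof.
move=> ez; have : normc (cexp z) = 1 by rewrite ez normc1.
rewrite normc_cexp => /(congr1 (@ln R)); rewrite expRK ln1 => rz.
have : cos (Im z) = 1.
  have := congr1 Re ez; rewrite /cexp rz expR0 /=; lra.
by move=> /cos_eq1[k iz]; exists k; case: z rz iz {ez} => a b /= -> ->.
Qed.

Lemma normc_tau k : normc (tau k) = `|k|%:~R * (pi *+ 2).
Proof.
by rewrite /= expr0n /= add0r sqrtr_sqr normrM intr_norm (ger0_norm pi2_ge0).
Qed.

Lemma iter_core_map_line n x y : cos y = -1 -> sin y = 0 ->
  iter n core_map (x +i* y) = iter n (@real_step R) x +i* y.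
Proof.
move=> cy sy; elim: n => //= n ->; rewrite /core_map /cexp /= cy sy /real_step.
by apply/eqP; rewrite eq_complex /=; apply/andP; split; apply/eqP; ring.
Qed.

Lemma cderiv_iter_line s n x y : cos y = -1 -> sin y = 0 ->
  cderiv (iter n (drift_map s)) (x +i* y) (orbit_multiplier x n)%:C.
Proof.
move=> cy sy; elim: n => [|n IH]; first exact: cderiv_id.
have := cderiv_comp (cderiv_drift_map s (iter n (drift_map s) (x +i* y))) IH.
have -> // : (1 - cexp (iter n (drift_map s) (x +i* y))) * (orbit_multiplier x n)%:C =
  (orbit_multiplier x n.+1)%:C.
rewrite iter_drift_map cexp_tau iter_core_map_line// /cexp /= cy sy.
by apply/eqP; rewrite eq_complex /=; apply/andP; split; apply/eqP; ring.
Qed.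

(** On such a line the real parts of the orbit tend to infinity, which excludes a
    finite limit.  A subsequence [F_n] of the iterates tending to infinity would have
    modulus greater than one on a fixed disc, and the Ahlfors-Schwarz inequality would
    bound the multiplier by a constant times [L * ln L], where [L] is a bound for [|F_n|] at
    the center; but the multiplier grows faster. *)
Lemma line_not_fatou s x y : cos y = -1 -> sin y = 0 -> ~ fatou (drift_map s) (x +i* y).
Proof.
move=> cy sy [V [oV Vz] nV].
set z0 := x +i* y in Vz.
have /normc_nbhsP[e e0 eV] : nbhs z0 V by exact: open_nbhs_nbhs.
pose r := e / 2; have r0 : 0 < r by rewrite divr_gt0.
have rV : compactly_in V (cdisc z0 r).
  split; last exact: cdisc_compact.
  by move=> w we; apply: eV; rewrite /disc /=; apply: le_lt_trans we _; rewrite /r; lra.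
have it n : iter n (drift_map s) z0 =
    iter n (@real_step R) x +i* (y + (s * n%:Z)%:~R * (pi *+ 2)).
  by rewrite iter_drift_map iter_core_map_line//; apply/eqP; rewrite eq_complex /= addr0 !eqxx.
have [phi phi_incr Hphi] :=
  nV (fun n => iter n (drift_map s)) (fun j => ex_intro2 _ _ j I erefl).
have phi_ge j : (j <= phi j)%N.
  elim: j => // j IH; apply: leq_ltn_trans IH _; exact: phi_incr.
case: Hphi => [[g /compact_cvgP Hg]|/cvg_inftyP Hoo].
  have V1 : compactly_in V [set z0].
    by split; [move=> _ -> | exact: compact_set1].
  have [N HN] := Hg _ V1 1 ltr01.
  have [N' HN'] := real_orbit_cvg x (normc (g z0) + 1).
  have := HN (maxn N N') (leq_maxl _ _) z0 erefl.
  have h1 : (N' <= phi (maxn N N'))%N by apply: leq_trans (phi_ge _); exact: leq_maxr.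
  have h2 := HN' _ h1.
  have h3 : iter (phi (maxn N N')) (@real_step R) x <=
      normc (iter (phi (maxn N N')) (drift_map s) z0).
    by apply: le_trans (normc_Re _); rewrite it; exact: ler_norm.
  have := le_normcD (iter (phi (maxn N N')) (drift_map s) z0 - g z0) (g z0).
  rewrite subrK; lra.
have [N HN] := Hoo _ rV 1.
have A0 : 0 <= `|s|%:~R * ((pi : R) *+ 2).
  by apply: mulr_ge0; [rewrite ler0z | exact: pi2_ge0].
have K0 : 0 <= 2 / r by rewrite divr_ge0// ltW.
have [N' HN'] := orbit_multiplier_dominates x A0 (normr_ge0 y) K0.
pose k := maxn N N'; pose n := phi k.
have N'n : (N' <= n)%N by apply: leq_trans (phi_ge _); exact: leq_maxr.
have F_gt1 : forall z, normc (z - z0) <= r -> 1 < normc (iter n (drift_map s) z).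
  by move=> z zr; apply: (HN k (leq_maxl _ _)).
have [F1 dF [F2 dF1 [F3 dF2 _]]] : smooth 3 (iter n (drift_map s)).
  by apply: smooth_iter; exact: smooth_drift_map.
have := ahlfors_schwarz dF dF1 dF2 r0 F_gt1.
rewrite (cderiv_unique (dF z0) (cderiv_iter_line s n x cy sy)).
rewrite normc_real ger0_norm; last by apply: le_trans (orbit_multiplier_ge1 _ _).
have := HN' n N'n; rewrite /=.
set L := `|_| + _ + _; set P := orbit_multiplier x n.
have FL : normc (iter n (drift_map s) z0) <= L.
  apply: (le_trans (normc_le_ReIm _)); rewrite it /= /L.
  have : `|y + (s * n%:Z)%:~R * (pi *+ 2)| <= `|y| + `|s|%:~R * (pi *+ 2) * n%:R.
    apply: (le_trans (ler_normD _ _)); rewrite lerD2l normrM -intr_norm normrM.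
    rewrite (ger0_norm pi2_ge0) rmorphM /=.
    by rewrite mulrAC -pmulrn.
  lra.
have F1z : 1 < normc (iter n (drift_map s) z0) by apply: F_gt1; rewrite subrr normc0 ltW.
set Fz := normc _ in FL F1z *.
have lnF : 0 <= ln Fz by rewrite ln_ge0// ltW.
have lnFL : ln Fz <= ln L by rewrite ler_ln ?posrE//; lra.
have FLL : Fz * ln Fz <= L * ln L by apply: ler_pM => //; lra.
have -> : 2 / r * (L * ln L) = 2 * (L * ln L) / r by ring.
rewrite ltr_pdivrMr//; lra.
Qed.

Lemma strip_of_tau s k w : fatou (drift_map s) (tau k) ->
  connected_component (fatou (drift_map s)) (tau k) w ->
  `|Im w - k%:~R * (pi *+ 2)| < pi.
Proof.
move=> Fk kw; have pi0 := pi_gt0 R.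
have : k%:~R * (pi *+ 2) - pi < Im w < k%:~R * (pi *+ 2) + pi.
  apply: component_strip kw => //; first by rewrite /tau /=; apply/andP; split; lra.
  move=> [a b] /= H.
  have : cos b = -1 /\ sin b = 0.
    case: H => ->.
      have -> : k%:~R * (pi *+ 2) - pi = - pi + k%:~R * ((pi : R) *+ 2) by ring.
      by rewrite cos_int sin_int cosN sinN cospi sinpi oppr0.
    have -> : k%:~R * (pi *+ 2) + pi = pi + k%:~R * ((pi : R) *+ 2) by ring.
    by rewrite cos_int sin_int cospi sinpi.
  by move=> [cb sb]; exact: line_not_fatou.
by rewrite ltr_distl => /andP[? ?]; apply/andP; split; lra.
Qed.

Lemma strips_disjoint s k l : k <> l ->
  fatou (drift_map s) (tau k) -> fatou (drift_map s) (tau l) ->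
  connected_component (fatou (drift_map s)) (tau k) `&`
  connected_component (fatou (drift_map s)) (tau l) = set0.
Proof.
move=> kl Fk Fl; apply/seteqP; split=> // w.
move=> [/strip_of_tau -/(_ Fk) h1 /strip_of_tau -/(_ Fl) h2].
have pi0 := pi_gt0 R.
apply: kl; apply/eqP; rewrite -subr_eq0 -normr_le0 -ltzD1 add0r.
rewrite -(ltr_int R) intr_norm rmorphB /=.
have : `|(k%:~R - l%:~R) * (pi *+ 2)| < (pi : R) *+ 2.
  have -> : (k%:~R - l%:~R) * (pi *+ 2) =
    (Im w - l%:~R * (pi *+ 2)) - (Im w - k%:~R * ((pi : R) *+ 2)) by ring.
  by apply: le_lt_trans (ler_normB _ _) _; rewrite mulr2n; lra.
rewrite normrM (ger0_norm pi2_ge0).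
by rewrite -{2}[pi *+ 2]mul1r ltr_pM2r// mulrn_wgt0.
Qed.
End Maps.

(** * The attracted discs *)

Section Example.
Variable R : realType.
Local Notation C := R[i].
Local Notation fatou := Defs.fatou.
Local Notation core_map := (@core_map R).
Local Notation drift_map := (@drift_map R).
Local Notation tau := (@tau R).
Implicit Types (z w a : C) (k s : int) (x y : R).

Definition core_map2 : C -> C := core_map \o core_map.

Lemma iter_core_map2 n z : iter n core_map2 z = iter n.*2 core_map z.
Proof. by elim: n => //= n ->. Qed.

(** The rate of attraction is recorded because normality is derived from it twice, for
    the drifting maps and for the second iterate of [core_map]. *)
Definition in_basin k (D : set C) : Prop :=
  exists2 r : R, 0 < r & D = disc (tau k) r /\
    forall n z, disc (tau k) r z -> normc (iter n core_map z - tau k) <= r / 2 ^+ n.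

Lemma basin_exists k : exists D, in_basin k D.
Proof.
have d0 : cderiv core_map (tau k) 0.
  by have := cderiv_core_map (tau k); rewrite -[tau k]add0r cexp_tau cexp0 subrr.
have [r r0 Hr] := superattracting_basin (core_map_fix R k) d0.
by exists (disc (tau k) r), r.
Qed.

(** The iterates stay close to [tau k] up to the drift, which tends to infinity. *)
Lemma basin_fatou_drift_map s k D : s != 0 -> in_basin k D -> D `<=` fatou (drift_map s).
Proof.
move=> s0 [r r0 [-> Hr]] z zr; exists (disc (tau k) r).
  by split => //; exact: disc_open.
apply: normal_range; right; apply/cvg_inftyP => K [KV _] M.
have pi2 : 0 < (pi : R) *+ 2 by rewrite mulrn_wgt0// pi_gt0.
have [N HN] := eventually_ge_natr ((M + r + normc (tau k) + 1) / (pi *+ 2)).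
exists N => n /HN; rewrite ler_pdivrMr// => Nn w Kw.
have h1 := Hr n w (KV _ Kw).
have h2 : r / 2 ^+ n <= r.
  by rewrite ler_pdivrMr ?exprn_gt0// ler_peMr ?(ltW r0)// exprn_ege1// ler1n.
have h3 : n%:R * (pi *+ 2) <= normc (tau (s * n%:Z)).
  rewrite normc_tau normrM rmorphM /= ler_wpM2r ?pi2_ge0// -pmulrn ler_peMl//.
  have : 1 <= `|s| by rewrite -gtz0_ge1 normr_gt0.
  by rewrite -(ler_int R).
have E : tau (s * n%:Z) = iter n (drift_map s) w - (iter n core_map w - tau k) - tau k.
  by rewrite iter_drift_map; ring.
have := le_normcD (iter n (drift_map s) w - (iter n core_map w - tau k)) (- tau k).
have := le_normcD (iter n (drift_map s) w) (- (iter n core_map w - tau k)).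
rewrite -E !normcN; lra.
Qed.

Lemma basin_fatou_core_map2 k D : in_basin k D -> D `<=` fatou core_map2.
Proof.
move=> [r r0 [-> Hr]] z zr; exists (disc (tau k) r).
  by split => //; exact: disc_open.
apply: normal_range; left; exists (fun=> tau k); apply/compact_cvgP => K [KV _] e e0.
have [N HN] := eventually_ge_natr (r / e).
exists N => n /HN; rewrite ler_pdivrMr// => Nn w Kw.
rewrite iter_core_map2; apply: le_lt_trans (Hr _ _ (KV _ Kw)) _.
have n2 : n%:R < (2 : R) ^+ n.*2.
  rewrite -natrX ltr_nat; apply: leq_trans (ltn_expl n (ltnSn 1)) _.
  by rewrite leq_exp2l// -addnn leq_addr.
by rewrite ltr_pdivrMr ?exprn_gt0// mulrC; apply: le_lt_trans Nn _; rewrite ltr_pM2r.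
Qed.

Lemma in_basin_center k D : in_basin k D -> D (tau k).
Proof. by move=> [r r0 [-> _]]; exact: disc_center. Qed.

Lemma tau_fatou_drift_map s k : s != 0 -> fatou (drift_map s) (tau k).
Proof.
move=> s0; have [D kD] := basin_exists k.
exact: (basin_fatou_drift_map s0 kD (in_basin_center kD)).
Qed.

Lemma tau_fatou_core_map2 k : fatou core_map2 (tau k).
Proof.
by have [D kD] := basin_exists k; exact: (basin_fatou_core_map2 kD (in_basin_center kD)).
Qed.

Lemma continuous_multiplier z : {for z, continuous (fun w => 1 - cexp w)}.
Proof.
have d1 := cderivM (cderiv_cst (-1) z) (cderiv_cexp z).
have := cderiv_continuous (cderivD (cderiv_cst 1 z) d1).
have -> // : (fun w => 1 + -1 * cexp w) = (fun w => 1 - cexp w).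
by apply/funext => w; rewrite mulN1r.
Qed.

Lemma multiplier_eq0 z : 1 - cexp z = 0 -> exists k, z = tau k.
Proof. by move=> /eqP; rewrite subr_eq0 eq_sym => /eqP/cexp_eq1. Qed.

Lemma drift_map_tau s k : drift_map s (tau k) = tau (k + s).
Proof. by rewrite /drift_map core_map_fix tauD. Qed.

(** A critical point is some [tau k], and its image is known to lie in the Fatou set;
    at the other points the map is open. *)
Lemma drift_map_forward s z : s != 0 ->
  fatou (drift_map s) z -> fatou (drift_map s) (drift_map s z).
Proof.
move=> s0 Fz; have [/multiplier_eq0[k ->]|nz] := eqVneq (1 - cexp z) 0.
  by rewrite drift_map_tau; exact: tau_fatou_drift_map.
exact: (fatou_forward (cderiv_drift_map s) (@continuous_multiplier z) nz Fz).
Qed.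

Lemma drift_map_continuous s : continuous (drift_map s).
Proof. by move=> z; exact: cderiv_continuous (cderiv_drift_map s z). Qed.

Lemma cderiv_core_map2 z : cderiv core_map2 z ((1 - cexp (core_map z)) * (1 - cexp z)).
Proof. exact: cderiv_comp (cderiv_core_map _) (cderiv_core_map _). Qed.

Lemma core_map2_continuous : continuous core_map2.
Proof. by move=> z; exact: cderiv_continuous (cderiv_core_map2 z). Qed.

Lemma core_map2_forward z : fatou core_map2 z -> fatou core_map2 (core_map2 z).
Proof.
move=> Fz.
have [/multiplier_eq0[k ->]|nz] := eqVneq (1 - cexp z) 0.
  by rewrite /core_map2 /= !core_map_fix; exact: tau_fatou_core_map2.
have [/multiplier_eq0[k hz]|nhz] := eqVneq (1 - cexp (core_map z)) 0.
  by rewrite /core_map2 /= hz core_map_fix; exact: tau_fatou_core_map2.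
apply: (fatou_forward cderiv_core_map2) Fz; last by rewrite mulf_neq0.
apply: ccontinuousM; last exact: continuous_multiplier.
have ch : {for z, continuous core_map} by exact: cderiv_continuous (cderiv_core_map z).
exact: (@continuous_comp _ _ _ core_map (fun w => 1 - cexp w) z ch (@continuous_multiplier _)).
Qed.

Lemma iter_drift_map_tau s k n : iter n (drift_map s) (tau k) = tau (k + s * n%:Z).
Proof.
rewrite iter_drift_map tauD; congr (_ + _).
by elim: n => //= n ->; rewrite core_map_fix.
Qed.

Lemma basin_connected k D : in_basin k D -> connected D.
Proof. by move=> [r r0 [-> _]]; exact: disc_connected. Qed.

Lemma basin_wandering s k D : s != 0 -> in_basin k D -> lies_in_wandering (drift_map s) D.
Proof.
move=> s0 kD.
apply: (@lies_in_wandering_component _ _ (@drift_map_continuous s)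
  (fun z => @drift_map_forward s z s0) (tau k)).
- exact: in_basin_center kD.
- exact: basin_connected kD.
- exact: basin_fatou_drift_map kD.
- move=> m n mn; rewrite !iter_drift_map_tau; apply: strips_disjoint.
  + by move=> /addrI/(mulfI s0) [].
  + exact: tau_fatou_drift_map.
  + exact: tau_fatou_drift_map.
Qed.

Lemma basin_fixed k D : in_basin k D -> lies_in_periodic core_map2 D.
Proof.
move=> kD; apply: (@lies_in_fixed_component _ _ core_map2_continuous core_map2_forward (tau k)).
- by rewrite /core_map2 /= !core_map_fix.
- exact: in_basin_center kD.
- exact: basin_connected kD.
- exact: basin_fatou_core_map2 kD.
Qed.

Lemma in_basin_inj k l D : in_basin k D -> in_basin l D -> k = l.
Proof.
move=> kD lD; apply/eqP; case: eqVneq => // /eqP kl; exfalso.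
have Dk := connected_fatou_sub (in_basin_center kD) (basin_connected kD)
  (@basin_fatou_drift_map 1 _ _ isT kD).
have Dl := connected_fatou_sub (in_basin_center lD) (basin_connected lD)
  (@basin_fatou_drift_map 1 _ _ isT lD).
have := @strips_disjoint R 1 k l kl
  (@tau_fatou_drift_map 1 k isT) (@tau_fatou_drift_map 1 l isT).
move/seteqP => [/(_ (tau k)) + _]; apply; split.
  exact: Dk (in_basin_center kD).
exact: Dl (in_basin_center kD).
Qed.

(** The exponential takes the value [1] at infinitely many points. *)
Lemma cexp_not_poly (p : {poly C}) : ~ forall z, cexp z = p.[z].
Proof.
move=> Hp.
have p1 : p = 1%:P.
  apply/eqP; rewrite -subr_eq0; apply/negPn/negP => n0.
  pose rs := [seq tau (i : nat)%:Z | i <- iota 0 (size (p - 1%:P))].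
  have ars : all (root (p - 1%:P)) rs.
    apply/allP => z /mapP[i _ ->]; rewrite rootE hornerD hornerN hornerC -Hp.
    by rewrite -[tau _]add0r cexp_tau cexp0 subrr.
  have urs : uniq rs.
    have pi2 : 0 < (pi : R) *+ 2 by rewrite mulrn_wgt0// pi_gt0.
    have pi2n : (pi : R) *+ 2 != 0 by rewrite gt_eqF.
    by rewrite map_inj_uniq ?iota_uniq// => i j [] /(mulIf pi2n)/intr_inj[].
  by have := max_poly_roots n0 ars urs; rewrite size_map size_iota ltnn.
have := Hp 1; rewrite p1 hornerC => /(congr1 (@normc R)).
rewrite normc_cexp normc1 /= => h.
by have := @expR_gt1Dx R 1 (oner_neq0 _); rewrite h; lra.
Qed.

Lemma drift_map_transcendental s : transcendental_entire (drift_map s).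
Proof.
split; first by apply: cderiv_entire => z; exists (1 - cexp z); exact: cderiv_drift_map.
move=> [p Hp]; apply: (@cexp_not_poly ('X + (1 + tau s)%:P - p)) => z.
by rewrite hornerD hornerN hornerD hornerX hornerC -Hp /drift_map /core_map; ring.
Qed.

Lemma drift_map_comp_eq : drift_map (-1) \o drift_map 1 = core_map2.
Proof. by apply/funext => z; exact: drift_map_comp. Qed.
End Example.

Theorem theorem2p1 (R : realType) :
  exists f g : R[i] -> R[i],
    [/\ transcendental_entire f, transcendental_entire g &
      infinite_set [set D : set R[i] |
        [/\ domain D, lies_in_wandering f D, lies_in_wandering g D &
            lies_in_periodic (g \o f) D]]].
Proof.
exists (@drift_map R 1), (@drift_map R (-1)); split; [exact: drift_map_transcendental..|].
have /choice[B HB] : forall n : nat, exists D : set R[i], in_basin (n : nat)%:Z D.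
  by move=> n; exact: basin_exists.
have Binj : {in [set: nat] &, injective B}.
  move=> m n _ _ Bmn; have := HB n; rewrite -Bmn => Bn.
  by have [] := in_basin_inj (HB m) Bn.
have : infinite_set (B @` [set: nat]).
  by rewrite (eq_finite_set (inj_card_eq Binj)); exact: infinite_nat.
apply: sub_infinite_set => _ [n _ <-]; split.
- split; first by exists (@tau R n%:Z); exact: in_basin_center (HB n).
    by have [r _ [-> _]] := HB n; exact: disc_open.
  exact: basin_connected (HB n).
- exact: basin_wandering (HB n).
- exact: basin_wandering (HB n).
- by rewrite drift_map_comp_eq; exact: basin_fixed (HB n).
Qed.
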